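(* Let $X$ be an abelian Polish group. Then for every analytic Haar-null set $A\subseteq X$, the set $$T(A)=\{\mu\in P(X): \mu(x+A)=0 \text{ for every } x\in X\}$$ is either a meager or a co-meager subset of $P(X)$.
   Context: $P(X)$ denotes the space of all Borel probability measures on $X$, equipped with the weak topology (convergence against bounded continuous real functions), which makes it a Polish space. A universally measurable set $A\subseteq X$ is called Haar-null if there exists $\mu\in P(X)$ (a test measure of $A$) such that $\mu(x+A)=0$ for every $x\in X$; here measures are extended to universally measurable sets via completion (analytic sets are universally measurable). *)

(* Defs.v *)
From HB Require Import structures.
From mathcomp Require Import all_boot all_order all_algebra.
From mathcomp Require Import all_classical all_reals all_analysis.
From mathcomp Require Import measurable_realfun.

Set Implicit Arguments.
Unset Strict Implicit.
Unset Printing Implicit Defensive.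

Import Order.TTheory GRing.Theory Num.Theory.
Import numFieldNormedType.Exports.

Local Open Scope classical_set_scope.
Local Open Scope ring_scope.

Section baire_category.
Context {T : topologicalType}.
Implicit Type A : set T.

Definition nowhere_dense A := interior (closure A) = set0.

Definition meager A :=
  exists2 F : (set T)^nat,
    (forall n, nowhere_dense (F n)) & A = \bigcup_n F n.

Definition comeager A := meager (~` A).

End baire_category.

Section polish_spaces.
Context (R : realType).

Definition separable (T : topologicalType) :=
  exists2 D : set T, countable D & dense D.

Definition is_metric (T : Type) (d : T -> T -> R) :=
  [/\ forall x y, 0 <= d x y,
      forall x y, d x y = 0 <-> x = y,
      forall x y, d x y = d y x
    & forall x y z, d x z <= d x y + d y z].

Definition metric_cauchy (T : Type) (d : T -> T -> R) (u : nat -> T) :=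
  forall e, 0 < e -> exists N : nat,
    forall m n, (N <= m)%N -> (N <= n)%N -> d (u m) (u n) < e.

Definition metric_induces (T : topologicalType) (d : T -> T -> R) :=
  forall (x : T) (U : set T),
    nbhs x U <-> exists2 e, 0 < e & [set y | d x y < e] `<=` U.

Definition completely_metrizable (T : topologicalType) :=
  exists d : T -> T -> R,
    [/\ is_metric d, metric_induces d
      & forall u : nat -> T, metric_cauchy d u ->
          exists l : T, u @ \oo --> l].

Definition polish (T : topologicalType) :=
  separable T /\ completely_metrizable T.

(* The empty set is analytic, as [Y] may be empty. *)
Definition analytic (T : topologicalType) (A : set T) :=
  exists Y : topologicalType, polish Y /\
    exists2 f : Y -> T, continuous f & A = range f.

End polish_spaces.

Definition borel (X : topologicalZmodType) : Type := X.

HB.instance Definition _ (X : topologicalZmodType) :=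
  Choice.copy (borel X) X.
HB.instance Definition _ (X : topologicalZmodType) :=
  isPointed.Build (borel X) (0 : X).

HB.instance Definition _ (X : topologicalZmodType) :=
  Measurable.copy (borel X) (g_sigma_algebraType (@open X : set (set (borel X)))).

Section borel_probability.
Context (R : realType) (X : topologicalZmodType).

(* A [probability] is a function on all subsets, with unconstrained values on
   the non-measurable ones. Fixing these values to 0 makes two elements equal
   as soon as they agree on Borel sets. *)
Record borel_probability := BorelProbability {
  bp_measure :> probability (borel X) R ;
  bp_out : forall A : set (borel X), ~ measurable A -> bp_measure A = 0%E }.

HB.instance Definition _ := gen_eqMixin borel_probability.
HB.instance Definition _ := gen_choiceMixin borel_probability.

Lemma borel_probability_eq (mu nu : borel_probability) :
  (forall A : set (borel X), measurable A -> mu A = nu A) -> mu = nu.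
Proof.
case: mu nu => [mu mu0] [nu nu0] /= munu.
have {}munu : mu = nu :> (set (borel X) -> \bar R).
  apply/funext => A; have [mA|nmA] := pselect (measurable A).
    exact: munu.
  by rewrite mu0 ?nu0.
have E : mu = nu.
  case: mu nu munu {mu0 nu0} => [m cm] [n cn] /= mn; subst n.
  case: cm cn => [[a1 a2] [a3] [a4] [a5] [a6] [a7] [a8]].
  case=> [[b1 b2] [b3] [b4] [b5] [b6] [b7] [b8]].
  move: a3 b3.
  rewrite (Prop_irrelevance b1 a1) (Prop_irrelevance b2 a2) => a3 b3.
  by rewrite (Prop_irrelevance b3 a3) (Prop_irrelevance b4 a4)
    (Prop_irrelevance b5 a5) (Prop_irrelevance b6 a6)
    (Prop_irrelevance b7 a7) (Prop_irrelevance b8 a8).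
by subst nu; congr BorelProbability; exact: Prop_irrelevance.
Qed.

Lemma borel_probability_of (nu : probability (borel X) R) :
  exists mu : borel_probability,
    forall A : set (borel X), measurable A -> mu A = nu A.
Proof.
pose m (A : set (borel X)) : \bar R := if `[< measurable A >] then nu A else 0%E.
have mE A : measurable A -> m A = nu A by move=> mA; rewrite /m asboolT.
have m0 : m set0 = 0%E by rewrite mE// measure0.
have m_ge0 A : (0 <= m A)%E by rewrite /m; case: ifP.
have m_sigma : semi_sigma_additive m.
  move=> F mF tF mUF; rewrite mE//.
  have -> : (fun n => \sum_(0 <= i < n) m (F i))%E =
            (fun n => \sum_(0 <= i < n) nu (F i))%E.
    by apply/funext => n; apply: eq_bigr => i _; rewrite mE.
  exact: measure_semi_sigma_additive.
pose mM := isMeasure.Build _ _ _ m m0 m_ge0 m_sigma.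
pose mm : {measure set (borel X) -> \bar R} := HB.pack m mM.
have mT : mm setT = 1%E by rewrite /= mE// probability_setT.
pose mP := Measure_isProbability.Build _ _ _ mm mT.
pose p : probability (borel X) R := HB.pack m mM mP.
have p0 A : ~ measurable A -> p A = 0%E by move=> nA; rewrite /= /m asboolF.
by exists (BorelProbability p0).
Qed.

Definition bounded_continuous :=
  {f : X -> R | continuous f /\ [bounded f x | x in [set: X]]}.

Definition integral_against (mu : borel_probability) :
    {ptws bounded_continuous -> R} :=
  fun f => \int[mu]_x (sval f x).

(* The weak topology: the coarsest one making mu |-> \int f dmu continuous for
   every bounded continuous f. *)
HB.instance Definition _ := Topological.copy borel_probability
  (initial_topology integral_against).

Lemma weak_cvgP (F : set_system borel_probability)
    (mu : borel_probability) : Filter F ->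
  F --> mu <-> forall f : bounded_continuous,
    integral_against nu f @[nu --> F] --> integral_against mu f.
Proof.
move=> FF; split.
  move=> Fmu f.
  have ct : {for mu, continuous integral_against}.
    exact: (@initial_continuous borel_probability
      {ptws bounded_continuous -> R} integral_against).
  have {ct Fmu} : integral_against @ F --> integral_against mu.
    exact: cvg_comp Fmu ct.
  move=> /cvg_sup/(_ f) Ff U /= oU.
  apply: (Ff ((fun g : bounded_continuous -> R => g f) @^-1` U)).
  exact: (@initial_continuous _ _
    (fun g : bounded_continuous -> R => g f) (integral_against mu)).
move=> Fmu.
have {}Fmu : integral_against @ F --> integral_against mu.
  apply/cvg_sup => f U /= [_ [[V oV <-] Vmu VU]].
  apply: filterS VU _; apply: (Fmu f).
  exact: open_nbhs_nbhs.
move=> U /= [_ [[V oV <-] Vmu VU]]; apply: filterS VU _.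
by apply: Fmu; exact: open_nbhs_nbhs.
Qed.

End borel_probability.

Section haar_null_sets.
Context (R : realType) (X : topologicalZmodType).
Implicit Types (A : set X) (mu : borel_probability R X).

Definition universally_measurable A :=
  forall mu, completed_algebra_gen mu (A : set (borel X)).

(* The outer measure induced by [mu], to be used on universally measurable sets
   only, where it is the completion of [mu] (see [completedE]). *)
Definition completed mu A : \bar R :=
  @completed_measure_extension _ _ _ (bp_measure mu) A.

Lemma completedE mu (B N : set (borel X)) :
  measurable B -> (bp_measure mu).-negligible N -> completed mu (B `|` N) = mu B.
Proof.
move=> mB [M [mM M0 NM]]; rewrite /completed /completed_measure_extension.
apply/eqP; rewrite eq_le; apply/andP; split.
  apply: (@le_trans _ _ ((bp_measure mu)^*%mu (B `|` M))).
    by apply: le_mu_ext; exact: setUS.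
  rewrite measurable_mu_extE/=; last exact: measurableU.
  apply: le_trans (measureU2 _ mB mM) _.
  by rewrite [X in (_ + X)%E]M0 adde0.
rewrite -(measurable_mu_extE (bp_measure mu) mB).
by apply: le_mu_ext; exact: subsetUl.
Qed.

Definition translate (x : X) A : set X := [set x + a | a in A].

Definition test_measures A : set (borel_probability R X) :=
  [set mu | forall x : X, completed mu (translate x A) = 0%E].

Definition haar_null A :=
  universally_measurable A /\ test_measures A !=set0.

End haar_null_sets.

Arguments universally_measurable R {X} A.
Arguments test_measures R {X} A.
Arguments haar_null R {X} A.

(* Main.v *)
Require Import Defs.
From HB Require Import structures.
From mathcomp Require Import all_boot all_order all_algebra.
From mathcomp Require Import all_classical all_reals all_analysis.
From mathcomp Require Import measurable_realfun.

(** Write [T] for the set of test measures of the analytic set [A].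

    The dichotomy is a zero-one law.  A continuous function [h] with values in
    some interval [[c, M]], [0 < c], acts on probability measures by sending
    [mu] to the normalization of [h mu].  This is a homeomorphism of [P(X)],
    its inverse being the action of [1 / h] ([reweight_homeomorphic]), and it
    maps [T] into itself, because [mu] and [h mu] have the same null sets
    ([reweight_null]).  The action is topologically transitive: if [lambda]
    gives positive mass to each term of a dense sequence, then concentrating
    [h] around finitely many of these terms makes [h lambda] approximate any
    finitely supported measure on the sequence, and those are dense
    ([reweight_orbit_dense], [reweight_transitive]).

    Suppose that the complement of [T] is a countable union of sets each of
    which is either meager or comeager in some nonempty open set.  If all of
    them are meager, [T] is comeager.  Otherwise [T] is meager in some nonempty
    open set [D], hence in each homeomorphic preimage of [D]; by transitivity
    these preimages have a dense union, and the Banach category theorem makes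
    [T] meager ([topological_zero_one]).

    It remains to see that the complement of [T] is such a union.  By Nikodym's
    theorem ([souslin_almost_closed]) the result of the Souslin operation on
    closed sets differs from a closed set by a meager set, so it is enough to
    write the complement as a countable union of such results.  Let [A] be the
    image of a Polish space [Y] by a continuous [f].  For a sequence of integers
    [sigma], the points of [Y] that lie, for all [i < n], within [1 / (i + 1)]
    of one of the first [sigma i + 1] terms of a dense sequence form a set
    [cell], whose intersection over [n] is totally bounded.  By completeness,
    the sets [closure (f (cell))] attached to the initial segments of [sigma]
    intersect inside [A] ([bigcap_closure_cell]).  Conversely, continuity from
    below of outer measures gives, whenever [mu (x + A) > c], some [sigma] for
    which all the [x + closure (f (cell))] have mass at least [c].  Thus [mu]
    fails to be a test measure iff, for some [k], [x] and [sigma], all these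
    masses are at least [1 / (k + 1)] ([test_measuresC_charging]).  The
    quantifier on [x] is absorbed into the Souslin operation by approximating
    [x] by terms of a dense sequence of [X]; the closures that this needs are
    harmless because [mu (x + C)] is upper semicontinuous in the pair [(mu, x)]
    when [C] is closed ([translate_semicontinuous], [charging_souslin]). *)

Set Implicit Arguments.
Unset Strict Implicit.
Unset Printing Implicit Defensive.

Import Order.TTheory GRing.Theory Num.Theory.
Import numFieldNormedType.Exports.

Local Open Scope classical_set_scope.
Local Open Scope ring_scope.

(** * Nowhere dense and meager sets *)

Section category.
Context {T : topologicalType}.
Implicit Types (A B S U V : set T).

Lemma nowhere_denseP A : nowhere_dense A <->
  forall U, open U -> U !=set0 ->
    exists V, [/\ open V, V !=set0, V `<=` U & V `&` A = set0].
Proof.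
split=> [ndA U oU [x Ux]|H].
  exists (U `&` ~` closure A); split.
  - by apply: openI => //; exact/closed_openC/closed_closure.
  - apply: contrapT => /set0P/negP/negPn/eqP U0.
    have : interior (closure A) x.
      apply: filterS (open_nbhs_nbhs (conj oU Ux)) => y Uy.
      by apply: contrapT => ny; suff : set0 y by []; rewrite -U0.
    by rewrite ndA.
  - exact: subIsetl.
  - apply/seteqP; split => // y [[_ ny] Ay]; apply: ny.
    exact: subset_closure.
apply/seteqP; split => // x xA.
have [V [oV [y Vy] VA V0]] := H _ (open_interior (closure A)) (ex_intro _ x xA).
have [z [Az Vz]] := interior_subset (VA _ Vy) _ (open_nbhs_nbhs (conj oV Vy)).
by suff : set0 z by []; rewrite -V0.
Qed.

Lemma nowhere_denseS A B : A `<=` B -> nowhere_dense B -> nowhere_dense A.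
Proof.
move=> AB ndB; apply/seteqP; split => // x.
by move=> /(interiorS (closureS AB)); rewrite ndB.
Qed.

Lemma closed_boundary_nowhere_dense A :
  closed A -> nowhere_dense (A `\` interior A).
Proof.
move=> cA; have cD : closed (A `\` interior A).
  by apply: closedI => //; exact/open_closedC/open_interior.
rewrite /nowhere_dense -((closure_id _).1 cD); apply/seteqP; split => // x.
by rewrite setDE interiorI interiorC => -[iAx]; apply; exact: subset_closure.
Qed.

Lemma open_boundary_nowhere_dense U : open U -> nowhere_dense (closure U `\` U).
Proof.
move=> oU; have := closed_boundary_nowhere_dense (open_closedC oU).
by rewrite setDE interiorC setCK setIC -setDE.
Qed.

Lemma nowhere_dense_meager A : nowhere_dense A -> meager A.
Proof. by move=> ndA; exists (fun=> A) => //; rewrite bigcup_const. Qed.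

Lemma meagerS A B : A `<=` B -> meager B -> meager A.
Proof.
move=> AB [F ndF BF]; exists (fun n => F n `&` A).
  by move=> n; exact: nowhere_denseS (ndF n).
by rewrite -setI_bigcupl -BF setIC; apply/esym/setIidPl.
Qed.

Lemma meager_bigcup (I : countType) (F : I -> set T) :
  (forall i, meager (F i)) -> meager (\bigcup_i F i).
Proof.
move=> mF; have /choice[G GF] : forall i, exists G : (set T)^nat,
    (forall n, nowhere_dense (G n)) /\ F i = \bigcup_n G n.
  by move=> i; have [G] := mF i; exists G.
exists (fun k => if unpickle k is Some (i, n) then G i n else set0).
  move=> k; case: (unpickle k) => [[i n]|]; first exact: (GF i).1.
  by rewrite /nowhere_dense closure0 interior0.
apply/seteqP; split => [x [i _]|x [k _]].
  rewrite (GF i).2 => -[n _ Gx]; exists (pickle (i, n)) => //.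
  by rewrite pickleK.
case: (unpickle k) => // -[i n] Gx; exists i => //.
by rewrite (GF i).2; exists n.
Qed.

Lemma meagerU A B : meager A -> meager B -> meager (A `|` B).
Proof.
move=> mA mB; apply: (@meagerS _ (\bigcup_(b : bool) if b then A else B)).
  by move=> x [Ax|Bx]; [exists true|exists false].
by apply: meager_bigcup => -[].
Qed.

(** Banach category theorem: local meagerness implies meagerness, in any space.
    A maximal disjoint family [D] of open sets in which [S] is meager has a
    union dense in that of [W].  Nowhere dense sets sitting in the distinct
    members of a disjoint family of open sets have a nowhere dense union, so
    the countable decompositions of the [S `&` U], [U] in [D], can be merged
    into a single one. *)
Lemma banach_category (W : set (set T)) S :
  (forall U, W U -> open U /\ meager (S `&` U)) ->
  meager (S `&` \bigcup_(U in W) U).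
Proof.
move=> HW.
pose Q := [set U : set T | open U /\ meager (S `&` U)].
have [D [DQ tD maxD]] := ex_maximal_disjoint_subcollection id Q.
pose O := \bigcup_(U in D) U.
have oO : open O by apply: bigcup_open => U /DQ[].
have /choice[F HF] : forall U, exists F : (set T)^nat,
    D U -> (forall n, nowhere_dense (F n)) /\ S `&` U = \bigcup_n F n.
  move=> U; have [DU|nDU] := pselect (D U); last by exists (fun=> set0).
  by have [_ [F ndF FE]] := DQ _ DU; exists F.
have mO : meager (S `&` O).
  apply: (@meagerS _ (\bigcup_n \bigcup_(U in D) F U n)).
    move=> x [Sx [U DU Ux]]; have : (S `&` U) x by [].
    by rewrite (HF _ DU).2 => -[n _ Fx]; exists n => //; exists U.
  apply: meager_bigcup => n; apply: nowhere_dense_meager.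
  apply/nowhere_denseP => V oV [x Vx].
  have FU U : D U -> F U n `<=` U.
    move=> DU; apply: (@subset_trans _ (S `&` U)); last exact: subIsetr.
    by rewrite (HF _ DU).2; exact: bigcup_sup.
  have [VO|/existsNP[U /not_implyP[DU /eqP/set0P VU]]] :=
    pselect (forall U, D U -> V `&` U = set0).
    exists V; split => //; first by exists x.
    apply/seteqP; split => // y [Vy [U DU /(FU _ DU) Uy]].
    by rewrite -(VO _ DU).
  have [V' [oV' V'0 V'V V'F]] := (nowhere_denseP _).1 ((HF _ DU).1 n) _
    (openI oV (DQ _ DU).1) VU.
  exists V'; split => //; first by move=> y /V'V[].
  apply/seteqP; split => // y [V'y [U' DU' Fy]].
  have UU' : U = U'.
    apply: tD => //; exists y; split; first by have [] := V'V _ V'y.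
    exact: (FU _ DU').
  by rewrite -V'F; split => //; rewrite UU'.
suff ndW : nowhere_dense ((\bigcup_(U in W) U) `\` O).
  apply: meagerS (meagerU mO (nowhere_dense_meager ndW)).
  move=> x [Sx Wx]; have [Ox|nOx] := pselect (O x); first by left.
  by right.
apply/nowhere_denseP => V oV [x Vx].
have [VO|/set0P VO] := eqVneq (V `&` O) set0; last first.
  exists (V `&` O); split; [exact: openI|by []|exact: subIsetl|].
  by apply/seteqP; split => // y [[_ Oy] []].
exists V; split => //; first by exists x.
apply/seteqP; split => // y [Vy [[U WU Uy] nOy]].
have [oU mU] := HW _ WU.
have VUO U' : D U' -> V `&` U `&` U' = set0.
  move=> DU'; apply/seteqP; split => // z [[Vz _] Uz].
  by rewrite -VO; split => //; exists U'.
have DVU : ~ D (V `&` U).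
  by move=> /VUO; rewrite setIid => VU0; suff : set0 y by []; rewrite -VU0.
apply: (maxD (D `|` [set V `&` U])).
- by split; [move=> ? ?; left|move=> DE; apply: DVU; apply: DE; right].
- move=> U' [/DQ//|->]; split; first exact: openI.
  by apply: meagerS mU => z [Sz [_ ?]].
move=> U1 U2 [DU1|->] [DU2|->] //.
- exact: tD.
- by move=> [z [U1z Vz]]; suff : set0 z by []; rewrite -(VUO _ DU1).
- by move=> [z [Vz U2z]]; suff : set0 z by []; rewrite -(VUO _ DU2).
Qed.

End category.

(** * The Souslin operation and the Baire property *)

Section souslin_operation.
Context {T : topologicalType} {I : countType}.
Implicit Types (A B S U V : set T) (G : seq I -> set T).

Definition souslin G : set T :=
  [set x | exists sigma : nat -> I, forall n, G (mkseq sigma n) x].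

(** The branches through [s] of the Souslin operation: the sets on which the
    proof of Nikodym's theorem inducts. *)
Definition souslin_from G (s : seq I) : set T :=
  [set x | exists2 sigma : nat -> I, mkseq sigma (size s) = s &
           forall n, G (mkseq sigma n) x].

(** The points near which [A] is nowhere meager: the least closed set that
    contains [A] up to a meager set. *)
Definition meager_hull A : set T :=
  ~` \bigcup_(U in [set U | open U /\ meager (A `&` U)]) U.

Lemma closed_meager_hull A : closed (meager_hull A).
Proof. by apply: open_closedC; apply: bigcup_open => U []. Qed.

Lemma meager_setD_hull A : meager (A `\` meager_hull A).
Proof. by rewrite /meager_hull setDE setCK; exact: banach_category. Qed.

Lemma meager_hull_subset A B : closed B -> A `<=` B -> meager_hull A `<=` B.
Proof.
move=> cB AB x hx; apply: contrapT => nBx; apply: hx; exists (~` B) => //.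
split; first exact: closed_openC.
apply: nowhere_dense_meager; apply: (@nowhere_denseS _ _ set0).
  by move=> y [/AB].
by rewrite /nowhere_dense closure0 interior0.
Qed.

(** Let [O] be the union of the interiors of the hulls of the [F i].  Outside
    the closure of [O], the set [A] is covered by the meager sets
    [F i `\` meager_hull (F i)] and by boundaries of closed sets, so the hull
    of [A] is contained in the closure of [O]; what remains lies on the
    boundary of [O]. *)
Lemma nowhere_dense_hull_bigcup A (F : I -> set T) : A = \bigcup_i F i ->
  nowhere_dense (meager_hull A `\` \bigcup_i meager_hull (F i)).
Proof.
move=> AE; pose O := \bigcup_i interior (meager_hull (F i)).
have oO : open O by apply: bigcup_open => i _; exact: open_interior.
apply: nowhere_denseS (open_boundary_nowhere_dense oO) => x [hAx nFx]; split.
  apply: contrapT => nOx; apply: hAx; exists (~` closure O) => //; split.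
    exact/closed_openC/closed_closure.
  apply: (@meagerS _ _ (\bigcup_i ((F i `\` meager_hull (F i)) `|`
      (meager_hull (F i) `\` interior (meager_hull (F i)))))).
    rewrite AE => y [[i _ Fy] nOy]; exists i => //.
    have [hy|nhy] := pselect (meager_hull (F i) y); [right|by left].
    by split => // iy; apply: nOy; apply: subset_closure; exists i.
  apply: meager_bigcup => i; apply: meagerU; first exact: meager_setD_hull.
  apply: nowhere_dense_meager; apply: closed_boundary_nowhere_dense.
  exact: closed_meager_hull.
by move=> [i _ /interior_subset Fx]; apply: nFx; exists i.
Qed.

Lemma souslin_fromE G s :
  souslin_from G s = \bigcup_i souslin_from G (rcons s i).
Proof.
apply/seteqP; split=> [x [sigma sE Gx]|x [i _ [sigma sE Gx]]].
  exists (sigma (size s)) => //; exists sigma => //.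
  by rewrite size_rcons mkseqS sE.
exists sigma => //; move: sE; rewrite size_rcons mkseqS => /eqP.
by rewrite eqseq_rcons => /andP[/eqP].
Qed.

Lemma souslin_from_nil G : souslin_from G [::] = souslin G.
Proof. by apply/seteqP; split => [x [s]|x [s]]; exists s. Qed.

Lemma souslin_from_subset G s : souslin_from G s `<=` G s.
Proof. by move=> x [sigma <-]; exact. Qed.

(** Nikodym's theorem.  A point of the hull of [souslin G] that avoids the
    countably many nowhere dense sets of [nowhere_dense_hull_bigcup] can be
    followed along a branch on which it stays in the hulls of the
    [souslin_from G s], hence in the closed sets [G s] themselves. *)
Lemma souslin_almost_closed G : (forall s, closed (G s)) ->
  exists B, [/\ closed B, meager (souslin G `\` B) & meager (B `\` souslin G)].
Proof.
move=> cG; pose B s := meager_hull (souslin_from G s).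
exists (B [::]); split; first exact: closed_meager_hull.
  by rewrite -souslin_from_nil; exact: meager_setD_hull.
apply: (@meagerS _ _ (\bigcup_s (B s `\` \bigcup_i B (rcons s i)))); last first.
  apply: meager_bigcup => s; apply: nowhere_dense_meager.
  exact/nowhere_dense_hull_bigcup/souslin_fromE.
move=> x [Bx nSx]; apply: contrapT => nM; apply: nSx.
have next s : exists i, B s x -> B (rcons s i) x.
  (* [I] may be empty: a default index is provided by the step from the root. *)
  have [Bsx|nBsx] := pselect (B s x); last first.
    have [i _] : (\bigcup_i B (rcons [::] i)) x.
      by apply: contrapT => nB; apply: nM; exists [::].
    by exists i.
  have [i _ Bi] : (\bigcup_i B (rcons s i)) x.
    by apply: contrapT => nB; apply: nM; exists s.
  by exists i.
have [nxt Hnxt] := choice next.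
pose t := fix t n := if n is n'.+1 then rcons (t n') (nxt (t n')) else [::].
exists (fun n => nxt (t n)) => n.
have -> : mkseq (fun n => nxt (t n)) n = t n.
  by elim: n => [//|n IH]; rewrite mkseqS IH.
suff : B (t n) x.
  by apply: meager_hull_subset => //; exact: souslin_from_subset.
by elim: n => //= n; exact: Hnxt.
Qed.

Lemma souslin_meager_or_residual G : (forall s, closed (G s)) ->
  meager (souslin G) \/
  exists2 O, open O /\ O !=set0 & meager (O `\` souslin G).
Proof.
move=> /souslin_almost_closed[B [cB mSB mBS]].
have [iB0|/set0P iB] := eqVneq (interior B) set0.
  left; apply: (@meagerS _ _ ((souslin G `\` B) `|` B)).
    by move=> x Sx; have [Bx|nBx] := pselect (B x); [right|left].
  apply: meagerU => //; apply: nowhere_dense_meager.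
  by rewrite /nowhere_dense -((closure_id _).1 cB).
right; exists (interior B); first by split; [exact: open_interior|].
by apply: meagerS mBS => x [/interior_subset].
Qed.

End souslin_operation.

(** * A topological zero-one law *)

Section topological_zero_one_law.
Context {T : topologicalType}.
Implicit Types (A U V F : set T).

Definition homeomorphic_pair (f g : T -> T) :=
  [/\ continuous f, continuous g, cancel f g & cancel g f].

Lemma nowhere_dense_preimage f g A : homeomorphic_pair f g ->
  nowhere_dense A -> nowhere_dense (f @^-1` A).
Proof.
move=> [cf cg fK gK] ndA; apply/nowhere_denseP => U oU [x Ux].
have oV : open (g @^-1` U) by apply: open_comp => // y _; exact: cg.
have V0 : g @^-1` U !=set0 by exists (f x); rewrite /= fK.
have [V [{}oV [y Vy] VU VA]] := (nowhere_denseP _).1 ndA _ oV V0.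
exists (f @^-1` V); split.
- by apply: open_comp => // z _; exact: cf.
- by exists (g y); rewrite /= gK.
- by move=> z /VU /=; rewrite fK.
- by rewrite -preimage_setI VA preimage_set0.
Qed.

Lemma meager_preimage f g A : homeomorphic_pair f g ->
  meager A -> meager (f @^-1` A).
Proof.
move=> fg [F ndF ->]; exists (fun n => f @^-1` F n).
  by move=> n; exact: nowhere_dense_preimage fg _.
by rewrite preimage_bigcup.
Qed.

(** The union of the open sets in which [F] is meager is dense as soon as it is
    nonempty, since the homeomorphisms carry a nonempty member of this family
    into a position where it meets any prescribed open set. *)
Lemma topological_zero_one F (G : nat -> set T) :
  ~` F = \bigcup_n G n ->
  (forall n, meager (G n) \/
    exists2 O, open O /\ O !=set0 & meager (O `\` G n)) ->
  (forall U V, open U -> U !=set0 -> open V -> V !=set0 ->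
    exists f g, [/\ homeomorphic_pair f g, forall x, F x -> F (f x)
                  & (V `&` f @^-1` U) !=set0]) ->
  meager F \/ comeager F.
Proof.
move=> FG HG tr; have [mG|/existsNP[n nmG]] := pselect (forall n, meager (G n)).
  by right; rewrite /comeager FG; exact: meager_bigcup.
left; have [mGn|[D [oO O0] mO]] := HG n; first by [].
pose W := [set U : set T | open U /\ meager (F `&` U)].
have FO : meager (F `&` D).
  apply: meagerS mO => x [Fx Dx]; split => // Gx.
  suff : (~` F) x by [].
  by rewrite FG; exists n.
have mW : meager (F `&` \bigcup_(U in W) U) by apply: banach_category => U.
have oW : open (\bigcup_(U in W) U) by apply: bigcup_open => U [].
have dW V : open V -> V !=set0 -> (V `&` \bigcup_(U in W) U) !=set0.
  move=> oV V0; have [f [g [fg Ff [x [Vx Ox]]]]] := tr _ _ oO O0 oV V0.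
  exists x; split => //; exists (f @^-1` D) => //; split.
    by case: fg => cf _ _ _; apply: open_comp => // y _; exact: cf.
  by apply: meagerS (meager_preimage fg FO) => y [/Ff Fy Oy].
apply: (@meagerS _ _ ((F `&` \bigcup_(U in W) U) `|`
   (setT `\` \bigcup_(U in W) U))).
  by move=> x Fx; have [Wx|nWx] := pselect ((\bigcup_(U in W) U) x); [left|right].
apply: meagerU => //; apply: nowhere_dense_meager.
apply/nowhere_denseP => V oV V0; exists (V `&` \bigcup_(U in W) U); split.
- exact: openI.
- exact: dW.
- exact: subIsetl.
- by apply/seteqP; split => // x [[_ Wx] []].
Qed.

End topological_zero_one_law.

(** * Probability measures with bounded densities *)

Definition norm_bounded {R : realType} {T : Type} (f : T -> R) :=
  exists M : R, forall x, `|f x| <= M.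

Section reweighting.
Context {R : realType} d {T : measurableType d}.
Implicit Types (mu nu : probability T R) (g h : T -> R).

Definition bounded_measurable g :=
  measurable_fun setT g /\ norm_bounded g.

Lemma bounded_measurable_integrable mu g :
  bounded_measurable g -> mu.-integrable setT (EFin \o g).
Proof.
move=> [mg [M gM]]; apply: measurable_bounded_integrable => //.
  by rewrite -ge0_fin_numE// fin_num_measure.
exists M; split; first exact: num_real.
by move=> x Mx t _; exact: le_trans (gM t) (ltW Mx).
Qed.

Lemma bounded_measurableM g h : bounded_measurable g -> bounded_measurable h ->
  bounded_measurable (g \* h).
Proof.
move=> [mg [M gM]] [mh [N hN]]; split; first exact: measurable_funM.
by exists (M * N) => x; rewrite normrM ler_pM.
Qed.

Lemma bounded_measurable_indic (A : set T) :
  measurable A -> bounded_measurable (\1_A : T -> R).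
Proof.
move=> mA; split; first exact: measurable_indic.
by exists 1 => x; rewrite indicE; case: (_ \in _); rewrite ?normr1 ?normr0.
Qed.

Lemma probability_Rintegral_cst mu (c : R) : \int[mu]_x c = c.
Proof.
rewrite Rintegral_cst// [X in fine X](_ : _ = 1%E) ?mulr1//.
exact: probability_setT.
Qed.

(** The measure with density [h / Z], where [Z] is the integral of [h]; the
    formula for integrals is the change of variables for the Radon-Nikodym
    derivative, which is almost everywhere [h / Z]. *)
Lemma reweighting_exists mu h : bounded_measurable h ->
  (forall x, 0 <= h x) -> 0 < \int[mu]_x h x ->
  exists nu, forall g, bounded_measurable g ->
    \int[nu]_x g x = (\int[mu]_x (g x * h x)) / \int[mu]_x h x.
Proof.
move=> bh h0; set Z := \int[mu]_x h x => Z0.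
have ih := bounded_measurable_integrable mu bh.
pose k x := h x / Z.
have k0 x : 0 <= k x by rewrite divr_ge0// ltW.
have mk : measurable_fun setT k by apply: measurable_funM => //; exact: bh.1.
have bk : bounded_measurable k.
  split=> //; case: bh => _ [M hM]; exists (M / Z) => x.
  rewrite /k normrM [`|Z^-1|]ger0_norm ?invr_ge0 ?(ltW Z0)//.
  by apply: ler_wpM2r => //; rewrite invr_ge0 ltW.
have ik := bounded_measurable_integrable mu bk.
pose m (A : set T) : \bar R := (\int[mu]_(x in A) (k x)%:E)%E.
have m0 : m set0 = 0%E by rewrite /m integral_set0.
have m_ge0 A : (0 <= m A)%E by apply: integral_ge0 => x _; rewrite lee_fin.
have m_sigma : semi_sigma_additive m.
  apply: semi_sigma_additive_nng_induced => [|x]; last by rewrite lee_fin.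
  exact/measurable_EFinP.
pose mM := isMeasure.Build _ _ _ m m0 m_ge0 m_sigma.
pose mm : {measure set T -> \bar R} := HB.pack m mM.
have mT : mm setT = 1%E.
  rewrite /= /m; have -> : 1%E = ((\int[mu]_x k x)%:E).
    rewrite /k RintegralZr//.
    by rewrite -/Z divff// gt_eqF.
  by rewrite fineK//; exact: integrable_fin_num.
pose mP := Measure_isProbability.Build _ _ _ mm mT.
pose nu : probability T R := HB.pack m mM mP.
have numu : nu `<< mu.
  apply/null_content_dominatesP => A mA muA /=.
  by rewrite /m; apply: null_set_integral => //; exact/measurable_EFinP/measurable_funTS.
exists nu => g bg.
have ig := bounded_measurable_integrable nu bg.
rewrite -RintegralZr//; last first.
  exact/bounded_measurable_integrable/bounded_measurableM.
rewrite /Rintegral -(Radon_Nikodym_change_of_variables numu)//; congr fine.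
apply: ae_eq_integral => //.
- apply: emeasurable_funM => //; first exact/measurable_EFinP/bg.1.
- apply/measurable_EFinP; apply: measurable_funM => //.
  by apply: measurable_funM; [exact: bg.1|exact: bh.1].
- have : ae_eq mu setT (Radon_Nikodym (charge_of_finite_measure nu) mu) (EFin \o k).
    apply: integral_ae_eq => //.
    + exact: Radon_Nikodym_integrable.
    + exact/measurable_EFinP.
    + by move=> E _ mE; rewrite -Radon_Nikodym_integral.
  apply: filterS => x /[apply] xE; rewrite xE /= -EFinM; congr (_%:E).
  by rewrite /k mulrA.
Qed.

End reweighting.

(** * Borel sets and outer measures *)

Section borel_sets.
Context {R : realType} {X : topologicalZmodType}.
Implicit Types (mu nu : borel_probability R X) (A B : set X).

Lemma open_borel A : open A -> measurable (A : set (borel X)).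
Proof. exact: sub_sigma_algebra. Qed.

Lemma closed_borel A : closed A -> measurable (A : set (borel X)).
Proof.
move=> cA; rewrite -[A]setCK; apply: measurableC.
exact: (open_borel (closed_openC cA)).
Qed.

Lemma continuous_borel (f : X -> R) :
  continuous f -> measurable_fun [set: borel X] f.
Proof.
move=> cf; apply: (measurability _ (RGenOpens.measurableE R)).
move=> _ [_ [a [b ->] <-]]; rewrite setTI; apply: open_borel.
by apply: open_comp => [x _|]; [exact: cf|exact: interval_open].
Qed.

(** The outer measure of [A] is attained by a countable intersection of
    countable covers of [A]. *)
Lemma measurable_hull mu A (r : R) : (completed mu A <= r%:E)%E ->
  exists B : set (borel X), [/\ measurable B, A `<=` B & (mu B <= r%:E)%E].
Proof.
move=> Ar.
have cover (n : nat) : exists B : set (borel X),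
    [/\ measurable B, A `<=` B & (mu B <= (r + n.+1%:R^-1)%:E)%E].
  have : (completed mu A < (r + n.+1%:R^-1)%:E)%E.
    by apply: le_lt_trans Ar _; rewrite lte_fin ltrDl invr_gt0.
  move=> /ereal_inf_lt[_ [F [mF AF] <-] Fr].
  exists (\bigcup_n F n); split => //; first exact: bigcup_measurable.
  apply: le_trans (ltW Fr); apply: measure_sigma_subadditive => //.
  exact: bigcup_measurable.
have [B HB] := choice cover.
have mB : measurable (\bigcap_n B n).
  by apply: bigcap_measurable => [|n _]; [exists 0%N|have [] := HB n].
exists (\bigcap_n B n); split => //.
  by move=> x Ax n _; have [_ AB _] := HB n; exact: AB.
apply/lee_addgt0Pr => e e0.
have [n ne] : exists n : nat, n.+1%:R^-1 < e.
  by have [n _ /(_ n (leqnn n))] := near_infty_natSinv_lt (PosNum e0); exists n.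
have [mBn _ Bn] := HB n.
apply: (@le_trans _ _ (mu (B n))).
  by apply: le_measure; rewrite ?inE//; exact: bigcap_inf.
by apply: (le_trans Bn); rewrite -EFinD lee_fin lerD2l ltW.
Qed.

Lemma completed_measurable mu (B : set (borel X)) :
  measurable B -> completed mu B = mu B.
Proof.
by move=> mB; rewrite -{1}(setU0 B) completedE//; exact: negligible_set0.
Qed.

Lemma completedS mu A B : A `<=` B -> (completed mu A <= completed mu B)%E.
Proof. by move=> AB; exact: le_mu_ext. Qed.

Lemma completed_ge0 mu A : (0 <= completed mu A)%E.
Proof. exact: mu_ext_ge0. Qed.

End borel_sets.

(** * Reweighting Borel probability measures *)

Section weak_topology.
Context {R : realType} {X : topologicalZmodType}.
Implicit Types (mu nu : borel_probability R X) (f g h : X -> R).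

Lemma bounded_continuous_measurable f : continuous f ->
  norm_bounded f -> @bounded_measurable R _ (borel X) f.
Proof. by move=> cf bf; split => //; exact: continuous_borel. Qed.

Lemma bounded_continuous_bound (f : bounded_continuous R X) :
  norm_bounded (sval f).
Proof.
case: f => f [cf bf] /=; case: bf => M [_ HM]; exists (M + 1) => x.
by apply: HM => //; rewrite ltrDl.
Qed.

Lemma bounded_continuous_of f : continuous f ->
  norm_bounded f ->
  exists f' : bounded_continuous R X, sval f' = f.
Proof.
move=> cf [M fM].
have bf : [bounded f x | x in [set: X]].
  exists M; split; first exact: num_real.
  by move=> x Mx t _; exact: le_trans (fM t) (ltW Mx).
by exists (exist _ f (conj cf bf)).
Qed.

Lemma integral_continuous f : continuous f ->
  norm_bounded f ->
  continuous (fun mu => \int[mu]_x f x).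
Proof.
move=> cf bf mu; have [f' <-] := bounded_continuous_of cf bf.
have /weak_cvgP/(_ f') : nbhs mu --> mu by exact: cvg_id.
exact.
Qed.

Lemma continuous_weak (T : topologicalType) (F : T -> borel_probability R X) :
  (forall f, continuous f -> norm_bounded f ->
    continuous (fun t => \int[F t]_x f x)) ->
  continuous F.
Proof.
move=> HF t; apply/weak_cvgP => f.
have bf := bounded_continuous_bound f.
by case: f bf => f [cf ?] bf; exact: (HF f cf bf t).
Qed.

Lemma weak_cvg_seq (u : nat -> borel_probability R X) mu :
  (forall f, continuous f -> norm_bounded f ->
    \int[u n]_x f x @[n --> \oo] --> \int[mu]_x f x) ->
  u n @[n --> \oo] --> mu.
Proof.
move=> Hu; apply/weak_cvgP => f.
have bf := bounded_continuous_bound f.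
by case: f bf => f [cf ?] bf; exact: (Hu f cf bf).
Qed.

Lemma borel_probability_integral_eq mu nu :
  (forall g, @bounded_measurable R _ (borel X) g ->
    \int[mu]_x g x = \int[nu]_x g x) -> mu = nu.
Proof.
move=> H; apply: borel_probability_eq => A mA.
have E (m : borel_probability R X) : m A = (\int[m]_x \1_A x)%:E.
  rewrite fineK ?integral_indic ?setIT//.
  exact: fin_num_measure.
by rewrite !E H//; exact: bounded_measurable_indic.
Qed.

Definition continuous_weight h := continuous h /\
  exists c M : R, 0 < c /\ forall x, c <= h x <= M.

Lemma continuous_weight_bounded h : continuous_weight h ->
  norm_bounded h.
Proof.
move=> [_ [c [M [c0 hM]]]]; exists M => x; have /andP[ch ?] := hM x.
by rewrite ger0_norm// (le_trans (ltW c0)).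
Qed.

Lemma continuous_weight_gt0 h x : continuous_weight h -> 0 < h x.
Proof.
by move=> [_ [c [M [c0 /(_ x) /andP[cx _]]]]]; exact: lt_le_trans cx.
Qed.

Lemma continuous_weightV h :
  continuous_weight h -> continuous_weight (fun x => (h x)^-1).
Proof.
move=> wh; have h0 x := continuous_weight_gt0 x wh.
case: (wh) => ch [c [M [c0 hM]]].
split.
  by move=> x; apply: cvgV; [rewrite gt_eqF|exact: ch].
exists M^-1, c^-1; have M0 : 0 < M.
  by have /andP[_] := hM 0; exact: lt_le_trans.
split; first by rewrite invr_gt0.
by move=> x; have /andP[? ?] := hM x; rewrite !lef_pV2 ?posrE//; apply/andP.
Qed.

Lemma continuous_weightM h k : continuous_weight h -> continuous_weight k ->
  continuous_weight (fun x => h x * k x).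
Proof.
move=> [ch [c [M [c0 hM]]]] [ck [d [N [d0 kN]]]]; split.
  by move=> x; apply: cvgM; [exact: ch|exact: ck].
exists (c * d), (M * N); split; first exact: mulr_gt0.
move=> x; have /andP[ch1 hM1] := hM x; have /andP[dk kN1] := kN x.
have h0 := lt_le_trans c0 ch1; have k0 := lt_le_trans d0 dk.
by rewrite !ler_pM// ltW.
Qed.

Lemma continuous_weight_measurable h : continuous_weight h ->
  @bounded_measurable R _ (borel X) h.
Proof.
move=> wh; apply: bounded_continuous_measurable; first exact: wh.1.
exact: continuous_weight_bounded.
Qed.

Lemma continuous_weight_integral_gt0 mu h : continuous_weight h ->
  0 < \int[mu]_x h x.
Proof.
move=> wh; have ih := bounded_measurable_integrable mu
  (continuous_weight_measurable wh).
case: wh => ch [c [M [c0 hM]]]; apply: (lt_le_trans c0).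
rewrite -[leLHS](probability_Rintegral_cst mu).
apply: le_Rintegral => // [|x _]; last by have /andP[] := hM x.
apply: bounded_measurable_integrable; split => //.
by exists `|c|.
Qed.

Lemma reweight_exists h mu : continuous_weight h ->
  exists nu, forall g, @bounded_measurable R _ (borel X) g ->
    \int[nu]_x g x = (\int[mu]_x (g x * h x)) / \int[mu]_x h x.
Proof.
move=> wh; have [|nu0 Hnu0] := @reweighting_exists R _ (borel X) mu h
  (continuous_weight_measurable wh) _ (continuous_weight_integral_gt0 mu wh).
  by move=> x; rewrite ltW// continuous_weight_gt0.
have [nu Hnu] := borel_probability_of nu0.
exists nu => g bg; rewrite -Hnu0//; congr fine.
by apply: eq_measure_integral => A mA _; exact: Hnu.
Qed.

(** Made total by the identity when [h] is not a weight, so that it can be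
    composed freely. *)
Definition reweight h mu : borel_probability R X :=
  if pselect (continuous_weight h) is left wh
  then sval (cid (reweight_exists mu wh)) else mu.

Lemma reweightE h mu g : continuous_weight h ->
  @bounded_measurable R _ (borel X) g ->
  \int[reweight h mu]_x g x = (\int[mu]_x (g x * h x)) / \int[mu]_x h x.
Proof.
by move=> wh; rewrite /reweight; case: pselect => // ?; case: cid => /= nu; exact.
Qed.

Lemma reweight_continuous h : continuous_weight h -> continuous (reweight h).
Proof.
move=> wh; apply: continuous_weak => f cf bf.
have -> : (fun mu => \int[reweight h mu]_x f x) =
    (fun mu => (\int[mu]_x (f x * h x)) / \int[mu]_x h x).
  apply/funext => mu; rewrite reweightE//.
  exact: bounded_continuous_measurable.
have bh := continuous_weight_bounded wh.
have cfh : continuous (fun mu => \int[mu]_x (f x * h x)).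
  apply: integral_continuous.
    by move=> x; apply: cvgM; [exact: cf|exact: wh.1].
  case: bf bh => [M fM] [N hN]; exists (M * N) => x.
  by rewrite normrM ler_pM.
have ch := integral_continuous wh.1 bh.
move=> mu; apply: cvgM; [exact: nbhs_filter|exact: cfh|].
apply: cvgV; [exact: nbhs_filter| |exact: ch].
by rewrite gt_eqF// continuous_weight_integral_gt0.
Qed.

Lemma reweight_reweight h k mu : continuous_weight h -> continuous_weight k ->
  reweight k (reweight h mu) = reweight (fun x => k x * h x) mu.
Proof.
move=> wh wk; apply: borel_probability_integral_eq => g bg.
have mh := continuous_weight_measurable wh.
have mk := continuous_weight_measurable wk.
rewrite !reweightE//; [|exact: continuous_weightM|exact: bounded_measurableM].
have h0 := lt0r_neq0 (continuous_weight_integral_gt0 mu wh).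
rewrite invf_div mulrA divfK//; congr (_ / _).
by apply: eq_Rintegral => x _; rewrite mulrA.
Qed.

Lemma reweightK h : continuous_weight h ->
  cancel (reweight h) (reweight (fun x => (h x)^-1)).
Proof.
move=> wh mu; rewrite reweight_reweight//; last exact: continuous_weightV.
have -> : (fun x => (h x)^-1 * h x) = cst 1.
  by apply/funext => x; rewrite mulVf// gt_eqF// continuous_weight_gt0.
have w1 : continuous_weight (cst 1 : X -> R).
  split; first exact: cst_continuous.
  by exists 1, 1; split => // x; rewrite lexx.
apply: borel_probability_integral_eq => g bg.
rewrite reweightE//= probability_Rintegral_cst divr1.
by apply: eq_Rintegral => x _; rewrite mulr1.
Qed.

Lemma reweight_homeomorphic h : continuous_weight h ->
  homeomorphic_pair (reweight h) (reweight (fun x => (h x)^-1)).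
Proof.
move=> wh; have wV := continuous_weightV wh; split.
- exact: reweight_continuous.
- exact: reweight_continuous.
- exact: reweightK.
- have -> : h = (fun x => ((h x)^-1)^-1) by apply/funext => x; rewrite invrK.
  under eq_fun do rewrite invrK.
  exact: reweightK.
Qed.

Lemma reweight_null h mu (A : set X) : continuous_weight h ->
  completed mu A = 0%E -> completed (reweight h mu) A = 0%E.
Proof.
move=> wh A0; have [|B [mB AB B0]] := @measurable_hull R X mu A 0.
  by rewrite A0.
have {}B0 : mu B = 0%E by apply/eqP; rewrite eq_le B0/=.
apply/eqP; rewrite eq_le completed_ge0 andbT.
apply: (le_trans (completedS _ AB)); rewrite completed_measurable//.
have -> : reweight h mu B = (\int[reweight h mu]_x \1_B x)%:E.
  by rewrite fineK ?integral_indic ?setIT// fin_num_measure.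
rewrite reweightE//; last exact: bounded_measurable_indic.
suff -> : \int[mu]_x (\1_B x * h x) = 0 by rewrite mul0r.
under eq_Rintegral do rewrite mulrC.
have := Rintegral_mkcond mu B h; rewrite patch_indic => <-.
rewrite /Rintegral null_set_integral//.
apply/measurable_EFinP/measurable_funTS.
exact: (continuous_weight_measurable wh).1.
Qed.

End weak_topology.

(** * Metrics, dense sequences and integrals *)

Section concrete_metrics.
Context {R : realType} {T : topologicalType} (d : T -> T -> R).
Hypotheses (md : is_metric d) (ind : metric_induces d).

Lemma metric_ge0 x y : 0 <= d x y. Proof. by case: md. Qed.

Lemma metric_sym x y : d x y = d y x. Proof. by case: md. Qed.

Lemma metric_refl x : d x x = 0. Proof. by case: md => _ H _ _; apply/H. Qed.

Lemma metric_eq0 x y : d x y = 0 -> x = y.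
Proof. by case: md => _ H _ _ /H. Qed.

Lemma metric_triangle y x z : d x z <= d x y + d y z.
Proof. by case: md. Qed.

Lemma nbhs_metric_ball x (e : R) : 0 < e -> nbhs x [set y | d x y < e].
Proof. by move=> e0; apply/ind; exists e. Qed.

Lemma open_metric_ball x (e : R) : open [set y | d x y < e].
Proof.
rewrite openE => y /= ye; apply/ind; exists (e - d x y).
  by rewrite subr_gt0.
move=> z /=; rewrite ltrBrDl; exact/le_lt_trans/metric_triangle.
Qed.

Lemma metric_hausdorff : hausdorff_space T.
Proof.
move=> x y xy; apply: metric_eq0; apply/eqP/negPn/negP => d0.
have {}d0 : 0 < d x y / 2.
  by rewrite divr_gt0// lt_def d0 metric_ge0.
have [z [/= xz yz]] := xy _ _ (nbhs_metric_ball x d0) (nbhs_metric_ball y d0).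
have := metric_triangle z x y; rewrite [d z y]metric_sym leNgt => /negP; apply.
by rewrite [ltRHS]splitr ltrD.
Qed.

Lemma metric_continuous a : continuous (d a).
Proof.
move=> x; apply/cvgrPdist_lt => e e0.
apply: filterS (nbhs_metric_ball x e0) => y /=; apply: le_lt_trans.
have := metric_triangle x a y; have := metric_triangle y a x.
rewrite [d y x]metric_sym => h1 h2; rewrite ler_norml; apply/andP; split.
  by rewrite lerNl opprB lerBlDl.
by rewrite lerBlDl.
Qed.

(** The point [x0] only provides default values: without it the dense set could
    be empty. *)
Lemma separable_sequence (x0 : T) : separable T ->
  exists e : nat -> T, forall U, open U -> U !=set0 -> exists n, U (e n).
Proof.
move=> [D cD dD].
have [f finj] : exists f : T -> nat, {in D &, injective f}.
  by case/countable_injP : cD => f fi; exists f.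
have /choice[e He] : forall n, exists x : T, forall y, D y -> f y = n -> x = y.
  move=> n; have [[y [Dy fy]]|nex] := pselect (exists y, D y /\ f y = n).
    by exists y => z Dz fz; apply: finj; rewrite ?inE// fy fz.
  by exists x0 => y Dy fy; exfalso; apply: nex; exists y.
exists e => U oU U0; have [y [Uy Dy]] := dD U U0 oU.
by exists (f y); rewrite (He _ y).
Qed.

End concrete_metrics.

Section probability_integrals.
Context {R : realType} d {T : measurableType d}.
Implicit Types (mu : probability T R).

Lemma bounded_convergence mu (u : nat -> T -> R) (f : T -> R) (M : R) :
  (forall n, measurable_fun setT (u n)) -> measurable_fun setT f ->
  (forall n x, `|u n x| <= M) ->
  (forall x, u n x @[n --> \oo] --> f x) ->
  \int[mu]_x u n x @[n --> \oo] --> \int[mu]_x f x.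
Proof.
move=> mu_ mf uM uf; apply: fine_cvg.
have fM x : `|f x| <= M.
  have : `|u n x| @[n --> \oo] --> `|f x| by exact: cvg_norm (uf x).
  move=> /cvg_lim <-//; apply: limr_le; last by near=> n.
  by apply/cvg_ex; exists `|f x|; apply: cvg_norm; exact: uf.
rewrite fineK; last first.
  apply: integrable_fin_num => //; apply: bounded_measurable_integrable.
  by split => //; exists M.
apply: (@dominated_cvg _ _ _ mu setT measurableT (fun n x => (u n x)%:E)
  (fun x => (f x)%:E) (cst M%:E)) => //.
- by move=> n; exact/measurable_EFinP.
- by move=> x _; apply: cvg_EFin; [near=> n|exact: uf].
- apply: (@bounded_measurable_integrable _ _ _ mu (cst M)).
  by split => //; exists `|M|.
- by move=> n x _ /=; rewrite lee_fin.
Unshelve. all: by end_near. Qed.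

Lemma Rintegral_indic_sum mu n (a : nat -> R) (A : nat -> set T) :
  (forall j, measurable (A j)) ->
  \int[mu]_x (\sum_(j < n) a j * \1_(A j) x) =
  \sum_(j < n) a j * fine (mu (A j)).
Proof.
move=> mA; have bA j : bounded_measurable (\1_(A j) : T -> R).
  exact: bounded_measurable_indic.
have bs m : bounded_measurable (fun x => \sum_(j < m) a j * \1_(A j) x).
  split.
    by apply: measurable_sum => j; apply: measurable_funM => //; exact: (bA j).1.
  exists (\sum_(j < m) `|a j|) => x; apply: le_trans (ler_norm_sum _ _ _) _.
  apply: ler_sum => j _; rewrite normrM ler_piMr// indicE.
  by case: (_ \in _); rewrite ?normr1 ?normr0.
elim: n => [|n IH].
  by under eq_Rintegral do rewrite big_ord0; rewrite probability_Rintegral_cst big_ord0.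
under eq_Rintegral do rewrite big_ord_recr/=.
rewrite RintegralD//=.
- rewrite IH big_ord_recr/= RintegralZl//; last exact: bounded_measurable_integrable.
  by rewrite [in LHS]/Rintegral integral_indic ?setIT.
- by apply: bounded_measurable_integrable; exact: bs.
- apply: bounded_measurable_integrable.
  apply: (@bounded_measurableM _ _ _ (cst (a n)) _ _ (bA n)).
  by split; [exact: measurable_cst|exists `|a n|].
Qed.

End probability_integrals.

(** * Approximation by finitely supported measures *)

Section dense_orbit.
Context {R : realType} {X : topologicalZmodType} (d : X -> X -> R).
Hypotheses (md : is_metric d) (ind : metric_induces d).
Variable e : nat -> X.
Hypothesis e_dense : forall U, open U -> U !=set0 -> exists n, U (e n).
Implicit Types (mu nu : borel_probability R X) (f g h : X -> R).

Lemma pushforward_borel_probability d' (T : measurableType d')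
    (P : probability T R) (phi : T -> borel X) : measurable_fun setT phi ->
  exists nu : borel_probability R X,
    (forall A : set (borel X), measurable A -> nu A = P (phi @^-1` A)) /\
    forall g, @bounded_measurable R _ (borel X) g ->
      \int[nu]_x g x = \int[P]_t g (phi t).
Proof.
move=> mphi.
pose phi' : {mfun T >-> borel X} :=
  HB.pack phi (isMeasurableFun.Build _ _ _ _ phi mphi).
have [nu Hnu] := borel_probability_of (distribution P phi').
exists nu; split; first by move=> A mA; rewrite Hnu.
move=> g bg.
have -> : \int[nu]_x g x = \int[distribution P phi']_x g x.
  by congr fine; apply: eq_measure_integral => A mA _; exact: Hnu.
rewrite /Rintegral; congr fine; rewrite integral_pushforward//.
  by apply/measurable_EFinP; case: bg.
rewrite preimage_setT.
apply: (@bounded_measurable_integrable _ _ _ P (g \o phi)).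
case: bg => mg [M gM]; split; last by exists M => t; exact: gM.
exact: measurableT_comp.
Qed.

(** The index of a term of [e 0, ..., e n] closest to [y]. *)
Fixpoint nearest n (y : X) : nat :=
  if n is m.+1 then
    if d y (e m.+1) < d y (e (nearest m y)) then m.+1 else nearest m y
  else 0%N.

Lemma nearest_le n y : (nearest n y <= n)%N.
Proof. by elim: n => //= n IH; case: ifP => // _; exact: leqW. Qed.

Lemma nearest_min n j y : (j <= n)%N -> d y (e (nearest n y)) <= d y (e j).
Proof.
elim: n j => [|n IH] j; first by rewrite leqn0 => /eqP ->.
rewrite leq_eqVlt => /predU1P[->/=|/ltnSE jn /=].
  by case: ltP.
by case: ltP => [/ltW ny|_]; [apply: le_trans ny _|]; exact: IH.
Qed.

Lemma measurable_dist a :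
  measurable_fun setT (fun y : borel X => d y a).
Proof.
have -> : (fun y => d y a) = d a by apply/funext => y; exact: metric_sym.
by apply: continuous_borel; exact: metric_continuous.
Qed.

Lemma measurable_nearest n :
  measurable_fun setT (nearest n : borel X -> nat).
Proof.
suff : measurable_fun setT (nearest n : borel X -> nat) /\
    measurable_fun setT (fun y : borel X => d y (e (nearest n y))) by case.
elim: n => [|n [IH1 IH2]]; first by
  split; [exact: measurable_cst|exact: (measurable_dist (e 0%N))].
have mlt : measurable_fun setT
    (fun y : borel X => d y (e n.+1) < d y (e (nearest n y))).
  by apply: measurable_fun_ltr => //; exact: (measurable_dist (e n.+1)).
split; first exact: measurable_fun_ifT.
rewrite /=.
have -> : (fun y : borel X => d y (e (if d y (e n.+1) < d y (e (nearest n y))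
    then n.+1 else nearest n y))) =
  (fun y : borel X => if d y (e n.+1) < d y (e (nearest n y))
    then d y (e n.+1) else d y (e (nearest n y))).
  by apply/funext => y; case: ifP.
by apply: measurable_fun_ifT => //; exact: (measurable_dist (e n.+1)).
Qed.

Lemma nearest_cvg y : e (nearest n y) @[n --> \oo] --> y.
Proof.
move=> U /= /ind[r r0 rU].
have [|j yj] := e_dense (open_metric_ball md ind y r).
  by exists y; rewrite /= (metric_refl md).
exists j => // n /= jn; apply: rU => /=.
exact: le_lt_trans (nearest_min y jn) yj.
Qed.

(** The image measures of [mu] by [e \o nearest n] converge to [mu], because
    these maps converge pointwise to the identity. *)
Lemma finitely_supported_approximation mu :
  exists u : nat -> borel_probability R X, u n @[n --> \oo] --> mu /\
    forall n g, @bounded_measurable R _ (borel X) g ->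
      \int[u n]_x g x =
      \sum_(j < n.+1) g (e j) * fine (mu (nearest n @^-1` [set nat_of_ord j])).
Proof.
have me n : measurable_fun setT (fun y : borel X => e (nearest n y) : borel X).
  apply: (@measurableT_comp _ _ _ _ _ _ (e : nat -> borel X)) => //.
  exact: measurable_nearest.
have /choice[u Hu] : forall n, exists nu : borel_probability R X, forall g,
    @bounded_measurable R _ (borel X) g ->
    \int[nu]_x g x = \int[mu]_y g (e (nearest n y)).
  move=> n; have [nu [_ Hnu]] := pushforward_borel_probability mu (me n).
  by exists nu.
exists u; split.
  apply: weak_cvg_seq => f cf [M fM].
  have bf : @bounded_measurable R _ (borel X) f.
    by apply: bounded_continuous_measurable => //; exists M.
  under eq_fun do rewrite Hu//.
  apply: (@bounded_convergence _ _ _ mu _ _ M) => //.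
  - by move=> n; apply: measurableT_comp (me n); exact: bf.1.
  - exact: bf.1.
  - by move=> y; apply: continuous_cvg; [exact: cf|exact: nearest_cvg].
move=> n g bg; rewrite Hu//.
rewrite -(@Rintegral_indic_sum _ _ _ mu n.+1 (g \o e)
    (fun j => nearest n @^-1` [set j])); last first.
  by move=> j; rewrite -[_ @^-1` _]setTI; exact: measurable_nearest.
apply: eq_Rintegral => y _.
have yn : (nearest n y < n.+1)%N by rewrite ltnS nearest_le.
rewrite (bigD1 (Ordinal yn))//= big1 ?addr0.
  by rewrite indicE mem_set// mulr1.
move=> j /eqP jn; rewrite indicE memNset ?mulr0// => /= yj.
by apply: jn; apply/val_inj; rewrite /= yj.
Qed.

End dense_orbit.

(** * Transitivity of reweighting *)

Section transitivity.
Context {R : realType} {X : topologicalZmodType} (d : X -> X -> R).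
Hypotheses (md : is_metric d) (ind : metric_induces d).
Variable e : nat -> X.
Hypothesis e_dense : forall U, open U -> U !=set0 -> exists n, U (e n).
Implicit Types (mu nu : borel_probability R X) (f g h : X -> R).

Lemma borel_set1 (a : X) : measurable ([set a] : set (borel X)).
Proof.
apply: closed_borel; apply: accessible_closed_set1.
exact/hausdorff_accessible/(metric_hausdorff md ind).
Qed.

(** The Poisson distribution charges every integer; its image by [e] charges
    every [e j]. *)
Lemma fully_atomic_probability :
  exists mu, forall j, 0 < fine (mu [set e j]).
Proof.
pose P : probability nat R := poisson_prob 1 0%N.
have [//|mu [Hmu _]] := @pushforward_borel_probability R X _ _ P e.
exists mu => j; rewrite Hmu; last exact: borel_set1.
have Pj : (0 < P [set j])%E.
  rewrite /P /= /poisson_prob ltr01 esum_set1.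
    rewrite lte_fin /poisson_pmf ltr01 expr1n mul1r.
    by rewrite mulr_gt0 ?expR_gt0// invr_gt0 ltr0n fact_gt0.
  by rewrite lee_fin poisson_pmf_ge0.
apply: fine_gt0; apply/andP; split.
  apply: (lt_le_trans Pj); apply: le_measure; rewrite ?inE//.
  by move=> _ ->.
by rewrite -ge0_fin_numE// fin_num_measure.
Qed.

(** Bump functions that decrease pointwise to the indicator of [a] as [m] grows. *)
Definition bump (m : nat) (a x : X) : R := Num.max 0 (1 - m.+1%:R * d a x).

Lemma bump_ge0 m a x : 0 <= bump m a x.
Proof. by rewrite /bump le_max lexx. Qed.

Lemma bump_le1 m a x : bump m a x <= 1.
Proof.
by rewrite /bump ge_max ler01/= gerBl mulr_ge0// metric_ge0.
Qed.

Lemma bump_continuous m a : continuous (bump m a).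
Proof.
move=> x; apply: (@continuous_max _ _ (cst 0) (fun y => 1 - m.+1%:R * d a y)).
  exact: cvg_cst.
apply: cvgB; first exact: cvg_cst.
apply: cvgM; first exact: cvg_cst.
exact: metric_continuous.
Qed.

Lemma bump_cvg a x : bump m a x @[m --> \oo] --> (\1_[set a] x : R).
Proof.
have [<-|/eqP xa] := eqVneq x a.
  rewrite indicE mem_set//; apply: cvg_near_cst; near=> m.
  by rewrite /bump (metric_refl md) mulr0 subr0; apply/max_idPr.
rewrite indicE memNset//.
have da : 0 < d a x.
  rewrite lt_def metric_ge0// andbT; apply/eqP => /(metric_eq0 md) ax.
  exact: xa.
apply: cvg_near_cst; near=> m; rewrite /bump; apply/max_idPl.
rewrite subr_le0 -ler_pdivrMr// mul1r.
near: m; have [n _ Hn] := near_infty_natSinv_lt (PosNum da).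
exists n => // m /= nm; have := Hn m nm => /= /ltW.
by rewrite -{1}[d a x]invrK lef_pV2 ?posrE// invr_gt0.
Unshelve. all: by end_near. Qed.

(** Let [nu] be finitely supported on the sequence [e], with weight [q j] on the
    index [j].  The sum [g] over [j] of [c j = q j / mu [set e j]] times the
    indicator of [e j] is the density of [nu] with respect to [mu], even if the
    [e j] are not distinct.  It is the pointwise bounded limit of the weights
    [h m] obtained by replacing indicators by bumps and by adding [1 / (m + 1)]
    to keep the weight away from zero. *)
Lemma reweight_orbit_dense mu : (forall j, 0 < fine (mu [set e j])) ->
  forall U : set (borel_probability R X), open U -> U !=set0 ->
  exists2 h, continuous_weight h & U (reweight h mu).
Proof.
move=> mue U oU [nu0 Unu0].
have [u [u_nu0 Hu]] := finitely_supported_approximation md ind e_dense nu0.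
have [n _ /(_ n (leqnn n)) /= Un] := u_nu0 U (open_nbhs_nbhs (conj oU Unu0)).
pose q (j : nat) := fine (nu0 (nearest d e n @^-1` [set j])).
pose c j := q j / fine (mu [set e j]).
have q0 j : 0 <= q j by apply: fine_ge0.
have c0 j : 0 <= c j by rewrite divr_ge0// ltW.
pose h (m : nat) x := m.+1%:R^-1 + \sum_(j < n.+1) c j * bump m (e j) x.
pose g x := \sum_(j < n.+1) c j * \1_[set e j] x.
pose M : R := 1 + \sum_(j < n.+1) c j.
have hM m x : 0 <= h m x <= M.
  apply/andP; split.
    by rewrite addr_ge0// sumr_ge0// => j _; rewrite mulr_ge0// bump_ge0.
  rewrite lerD//; first by rewrite invf_le1// ler1n.
  by apply: ler_sum => j _; rewrite ler_piMr// bump_le1.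
have wh m : continuous_weight (h m).
  split; last first.
    exists m.+1%:R^-1, M; split; first by rewrite invr_gt0.
    move=> x; have /andP[_ ->] := hM m x; rewrite andbT lerDl.
    by rewrite sumr_ge0// => j _; rewrite mulr_ge0// bump_ge0.
  move=> x; apply: cvgD; first exact: cvg_cst.
  apply: cvg_big => [|j _]; [exact: add_continuous|]; apply: cvgM; first exact: cvg_cst.
  exact: bump_continuous.
have hg x : h m x @[m --> \oo] --> g x.
  rewrite -[g x]add0r; apply: cvgD.
    exact: cvg_harmonic.
  apply: cvg_big => [|j _]; [exact: add_continuous|]; apply: cvgM; first exact: cvg_cst.
  exact: bump_cvg.
have mg : measurable_fun setT (g : borel X -> R).
  apply: measurable_sum => j; apply: measurable_funM => //.
  by apply: measurable_indic; exact: borel_set1.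
have int_fg f : @bounded_measurable R _ (borel X) f ->
    \int[mu]_x (f x * g x) = \int[u n]_x f x.
  move=> bf; rewrite Hu//.
  transitivity (\int[mu]_x (\sum_(j < n.+1) (c j * f (e j)) * \1_[set e j] x)).
    apply: eq_Rintegral => x _; rewrite /g mulr_sumr; apply: eq_bigr => j _.
    rewrite indicE; have [/set_mem ->|_] := boolP (x \in _).
      by rewrite !mulr1 mulrC.
    by rewrite !mulr0.
  rewrite (Rintegral_indic_sum mu n.+1 (fun j => c j * f (e j))
    (A := fun j => [set e j])); last by move=> j; exact: borel_set1.
  apply: eq_bigr => j _; rewrite /c mulrAC mulfVK ?gt_eqF// -/(q j) mulrC //.
have int_g : \int[mu]_x g x = 1.
  have b1 : @bounded_measurable R _ (borel X) (cst 1).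
    by split; [exact: measurable_cst|exists 1 => x; rewrite normr1].
  have := int_fg (cst 1) b1; rewrite probability_Rintegral_cst => <-.
  by apply: eq_Rintegral => x _ /=; rewrite mul1r.
have hnu : reweight (h m) mu @[m --> \oo] --> u n.
  apply: weak_cvg_seq => f cf [N fN].
  have bf : @bounded_measurable R _ (borel X) f.
    by apply: bounded_continuous_measurable => //; exists N.
  under eq_fun do rewrite reweightE//.
  have -> : \int[u n]_x f x = (\int[mu]_x (f x * g x)) / \int[mu]_x g x.
    by rewrite int_g divr1 int_fg.
  apply: cvgM.
    apply: (@bounded_convergence _ _ _ mu _ _ (N * M)).
    - move=> m; apply: measurable_funM; first exact: bf.1.
      exact: (continuous_weight_measurable (wh m)).1.
    - by apply: measurable_funM => //; exact: bf.1.
    - move=> m x; rewrite normrM ler_pM//.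
      by have /andP[? ?] := hM m x; rewrite ger0_norm.
    - by move=> x; apply: cvgM; [exact: cvg_cst|exact: hg].
  apply: cvgV; first by rewrite int_g oner_eq0.
  apply: (@bounded_convergence _ _ _ mu _ _ M) => //.
  - by move=> m; exact: (continuous_weight_measurable (wh m)).1.
  - by move=> m x; have /andP[? ?] := hM m x; rewrite ger0_norm.
have [m _ /(_ m (leqnn m)) /= Um] := hnu U (open_nbhs_nbhs (conj oU Un)).
by exists (h m).
Qed.

(** If reweighting by [h] and [k] brings [mu] into [U] and [V], then reweighting
    by [h / k] brings a point of [V] into [U]. *)
Lemma reweight_transitive (U V : set (borel_probability R X)) :
  open U -> U !=set0 -> open V -> V !=set0 ->
  exists2 h, continuous_weight h & (V `&` reweight h @^-1` U) !=set0.
Proof.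
move=> oU U0 oV V0; have [mu mue] := fully_atomic_probability.
have [h wh Uh] := reweight_orbit_dense mue oU U0.
have [k wk Vk] := reweight_orbit_dense mue oV V0.
have wV := continuous_weightV wk.
exists (fun x => h x * (k x)^-1); first exact: continuous_weightM.
exists (reweight k mu); split => //=.
rewrite reweight_reweight//; last exact: continuous_weightM.
congr U : Uh; congr (reweight _ _); apply/funext => x.
by rewrite mulfVK// gt_eqF// continuous_weight_gt0.
Qed.

End transitivity.

(** * Semicontinuity of masses of closed sets *)

Section semicontinuity.
Context {R : realType} {X : topologicalZmodType} (d : X -> X -> R).
Hypotheses (md : is_metric d) (ind : metric_induces d).
Implicit Types (mu nu : borel_probability R X) (U D : set X).

(** Lipschitz regularization of the indicator of [U]: the largest [k]-Lipschitz
    function below it.  Unlike the usual [min 1 (k d(y, ~` U))], it requires no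
    separate treatment of [U = setT]. *)
Definition lower_envelope U (k : nat) (y : X) : R :=
  inf [set \1_U z + k%:R * d y z | z in setT].

Lemma lower_envelope_lbound U k y :
  lbound [set \1_U z + k%:R * d y z | z in setT] 0.
Proof. by move=> _ [z _ <-]; rewrite addr_ge0// mulr_ge0// metric_ge0. Qed.

Lemma lower_envelope_le U k y z : lower_envelope U k y <= \1_U z + k%:R * d y z.
Proof.
by apply: ge_inf; [exists 0; exact: lower_envelope_lbound|exists z].
Qed.

Lemma le_lower_envelope U k y (c : R) :
  (forall z, c <= \1_U z + k%:R * d y z) -> c <= lower_envelope U k y.
Proof.
move=> H; apply: lb_le_inf; last by move=> _ [z _ <-].
by exists (\1_U y + k%:R * d y y); exists y.
Qed.

Lemma lower_envelope_ge0 U k y : 0 <= lower_envelope U k y.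
Proof.
by apply: le_lower_envelope => z; rewrite addr_ge0// mulr_ge0// metric_ge0.
Qed.

Lemma lower_envelope_le_indic U k y : lower_envelope U k y <= \1_U y.
Proof.
have := lower_envelope_le U k y y.
by rewrite (metric_refl md) mulr0 addr0.
Qed.

Lemma lower_envelope_lipschitz U k x y :
  lower_envelope U k x <= lower_envelope U k y + k%:R * d x y.
Proof.
rewrite -lerBlDr; apply: le_lower_envelope => z; rewrite lerBlDr.
apply: (le_trans (lower_envelope_le U k x z)); rewrite -addrA lerD2l -mulrDr.
by apply: ler_wpM2l => //; rewrite addrC; exact: metric_triangle.
Qed.

Lemma lower_envelope_continuous U k : continuous (lower_envelope U k).
Proof.
move=> x; apply/cvgrPdist_lt => r r0.
have rk : 0 < r / k.+1%:R by rewrite divr_gt0.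
apply: filterS (nbhs_metric_ball ind x rk) => y /= xy.
have kd : k%:R * d x y < r.
  apply: (@le_lt_trans _ _ (k.+1%:R * d x y)).
    by rewrite ler_wpM2r ?metric_ge0// ler_nat.
  by rewrite mulrC -ltr_pdivlMr.
apply: le_lt_trans kd; rewrite ler_norml; apply/andP; split.
  rewrite lerNl opprB lerBlDl.
  by have := lower_envelope_lipschitz U k y x; rewrite [d y x](metric_sym md).
by rewrite lerBlDl; exact: lower_envelope_lipschitz.
Qed.

Lemma lower_envelope_cvg U y : open U ->
  lower_envelope U k y @[k --> \oo] --> (\1_U y : R).
Proof.
move=> oU; have [Uy|nUy] := pselect (U y); last first.
  apply: cvg_near_cst; near=> k; apply/eqP; rewrite eq_le.
  rewrite lower_envelope_le_indic indicE memNset//=.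
  exact: lower_envelope_ge0.
have /ind[r r0 rU] : nbhs y U by exact: open_nbhs_nbhs.
apply: cvg_near_cst; near=> k; apply/eqP; rewrite eq_le.
rewrite lower_envelope_le_indic/= indicE mem_set//.
apply: le_lower_envelope => z; have [yz|yz] := ltP (d y z) r.
  by rewrite indicE mem_set ?lerDl ?mulr_ge0 ?(metric_ge0 md)//; exact: rU.
apply: (@le_trans _ _ (k%:R * d y z)); last by rewrite lerDr.
apply: (@le_trans _ _ (k%:R * r)); last by rewrite ler_wpM2l.
rewrite -ler_pdivrMr// mul1r; near: k.
exact: nbhs_infty_ger.
Unshelve. all: by end_near. Qed.

(** The integral of [lower_envelope U k] is continuous in the measure and, for
    an open [U], increases to the mass of [U]. *)
Lemma portmanteau_open U mu (c : R) : open U -> (c%:E < mu U)%E ->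
  nbhs mu [set nu : borel_probability R X | (c%:E < nu U)%E].
Proof.
move=> oU cU.
have mU : measurable (U : set (borel X)) by exact: open_borel.
have EU nu : nu U = (\int[nu]_x \1_U x)%:E.
  by rewrite fineK ?integral_indic ?setIT// fin_num_measure.
have b1 : @bounded_measurable R _ (borel X) \1_U by exact: bounded_measurable_indic.
have envB k : norm_bounded (lower_envelope U k).
  exists 1 => x; rewrite ger0_norm ?lower_envelope_ge0//.
  apply: (le_trans (lower_envelope_le_indic U k x)).
  by rewrite indicE; case: (_ \in _).
have mE k : @bounded_measurable R _ (borel X) (lower_envelope U k).
  by apply: bounded_continuous_measurable => //; exact: lower_envelope_continuous.
have cvE : \int[mu]_x lower_envelope U k x @[k --> \oo] --> \int[mu]_x \1_U x.
  apply: (@bounded_convergence _ _ _ mu _ _ 1).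
  - by move=> k; exact: (mE k).1.
  - exact: b1.1.
  - move=> k x; rewrite ger0_norm ?lower_envelope_ge0//.
    apply: (le_trans (lower_envelope_le_indic U k x)).
    by rewrite indicE; case: (_ \in _).
  - by move=> x; exact: lower_envelope_cvg.
move: cU; rewrite EU lte_fin => cU.
have [k _ /(_ k (leqnn k)) /= ck] := cvgr_gt _ cvE _ cU.
have cont : continuous (fun nu => \int[nu]_x lower_envelope U k x).
  exact: (integral_continuous (@lower_envelope_continuous U k) (envB k)).
apply: filterS (cvgr_gt _ (cont mu) _ ck) => nu /= ck'.
rewrite EU lte_fin; apply: (lt_le_trans ck'); apply: le_Rintegral => //.
- exact: bounded_measurable_integrable.
- exact: bounded_measurable_integrable.
- by move=> x _; exact: lower_envelope_le_indic.
Qed.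

Lemma portmanteau_closed D mu (c : R) : closed D -> (mu D < c%:E)%E ->
  nbhs mu [set nu : borel_probability R X | (nu D < c%:E)%E].
Proof.
move=> cD Dc; have mD : measurable (D : set (borel X)) by exact: closed_borel.
have ED nu : nu D = (1 - fine (nu (~` D)))%:E.
  have nuD : nu (~` D) \is a fin_num by exact/fin_num_measure/measurableC.
  by rewrite EFinB fineK// -[D in LHS]setCK probability_setC//; exact: measurableC.
have oD : open (~` D) by exact: closed_openC.
have : ((1 - c)%:E < mu (~` D))%E.
  rewrite -[mu (~` D)]fineK; last exact/fin_num_measure/measurableC.
  by rewrite lte_fin ltrBlDr addrC -ltrBlDr -lte_fin -ED.
move=> /(portmanteau_open oD) H; apply: filterS H => nu /=.
rewrite -[nu (~` D)]fineK; last exact/fin_num_measure/measurableC.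
by rewrite lte_fin ED lte_fin ltrBlDr addrC -ltrBlDr.
Qed.

(** Closed sets that contain all the [translate x' D] for [x'] near [x].  The
    thickening is along the group translations: the metric [d] is not assumed
    to be invariant, so metric neighborhoods of [D] would not do. *)
Definition thickening (x : X) D (n : nat) : set X :=
  closure [set y | exists2 x', d x x' < n.+1%:R^-1 & D (y - x')].

Lemma thickening_nonincreasing x D : nonincreasing_seq (thickening x D).
Proof.
move=> m n mn; apply/subsetPset; apply: closureS => y [x' xx' Dy].
exists x' => //; apply: (lt_le_trans xx').
by rewrite lef_pV2 ?posrE// ler_nat.
Qed.

Lemma translateE x D : translate x D = [set y | D (y - x)].
Proof.
apply/seteqP; split => [_ [a Da <-]|y Dy] /=; first by rewrite addrC addKr.
by exists (y - x) => //; rewrite addrC subrK.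
Qed.

Lemma bigcap_thickening x D : closed D ->
  \bigcap_n thickening x D n = translate x D.
Proof.
move=> cD; rewrite translateE; apply/seteqP; split => y; last first.
  move=> Dy n _; apply: subset_closure; exists x => //.
  by rewrite (metric_refl md) invr_gt0.
move=> Cy /=; apply: contrapT => nDy.
have : nbhs (y - x) (~` D) by apply: open_nbhs_nbhs; split => //; exact: closed_openC.
have subc : {for (y, x), continuous (fun z : X * X => z.1 - z.2)}.
  apply: (@continuous_comp _ _ _ (fun z : X * X => (z.1, - z.2))
    (fun z : X * X => z.1 + z.2)); last exact: add_continuous.
  apply: cvg_pair; first exact: cvg_fst.
  by apply: continuous_comp; [exact: cvg_snd|exact: opp_continuous].
move=> /subc[[/= A B] [Ay /ind[r r0 rB]] AB].
have [n _ /(_ n (leqnn n)) /= nr] := near_infty_natSinv_lt (PosNum r0).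
have [y' [[x' xx' Dy'] Ay']] := Cy n I _ Ay.
apply: (AB (y', x')) Dy'; split => //=; apply: rB => /=.
exact: lt_trans xx' nr.
Qed.

(** If the mass of [translate x D] is less than [c], so is that of some
    thickening of it, which is closed and does not depend on [x']. *)
Lemma translate_semicontinuous D mu x (c : R) : closed D ->
  (completed mu (translate x D) < c%:E)%E ->
  exists2 r, 0 < r & nbhs mu [set nu : borel_probability R X |
    forall x', d x x' < r -> (completed nu (translate x' D) < c%:E)%E].
Proof.
move=> cD; rewrite -bigcap_thickening//.
have cC n : closed (thickening x D n) by exact: closed_closure.
have mC n : measurable (thickening x D n : set (borel X)) by exact: closed_borel.
have mI : measurable (\bigcap_n thickening x D n : set (borel X)).
  by apply: bigcap_measurable => //; exists 0%N.
rewrite completed_measurable// => Dc.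
have cvC : mu (thickening x D n) @[n --> \oo] --> mu (\bigcap_n thickening x D n).
  apply: nonincreasing_cvg_mu => //; last exact: thickening_nonincreasing.
  by rewrite -ge0_fin_numE// fin_num_measure.
have [n _ /(_ n (leqnn n)) /= Cn] := cvC _ (open_ereal_lt' Dc).
exists n.+1%:R^-1; first by rewrite invr_gt0.
apply: filterS (portmanteau_closed (cC n) Cn) => nu /= Cnu x' xx'.
apply: le_lt_trans Cnu; rewrite -completed_measurable//; apply: completedS.
rewrite translateE => y Dy; apply: subset_closure; by exists x'.
Qed.

End semicontinuity.

(** * Analytic sets and capacities *)

Section souslin_representation_of_analytic_sets.
Context {R : realType} {X Y : topologicalType} (dY : Y -> Y -> R).
Hypotheses (mdY : is_metric dY) (indY : metric_induces dY).
Hypothesis completeY : forall u : nat -> Y, metric_cauchy dY u ->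
  exists l : Y, u @ \oo --> l.
Variable e : nat -> Y.
Hypothesis e_dense : forall U, open U -> U !=set0 -> exists n, U (e n).
Variable f : Y -> X.
Hypothesis cf : continuous f.
Hypothesis hausX : hausdorff_space X.

(** The points with a code bounded by [s], when the codes of a point [y] are
    the sequences [tau] such that [e (tau i)] is within [1 / (i + 1)] of [y]
    for all [i].  Bounding a code, instead of prescribing it, makes the cell
    increase with each entry of [s], as continuity from below demands. *)
Definition cell (s : seq nat) : set Y :=
  [set y | forall i, (i < size s)%N ->
    exists2 j, (j <= nth 0 s i)%N & dY (e j) y < i.+1%:R^-1].

Lemma cell_nil : cell [::] = setT.
Proof. by apply/seteqP; split. Qed.

Lemma cell_rcons s k : cell (rcons s k) =
  cell s `&` [set y | exists2 j, (j <= k)%N & dY (e j) y < (size s).+1%:R^-1].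
Proof.
apply/seteqP; split => y.
  move=> H; split.
    move=> i si; have := H i; rewrite size_rcons nth_rcons si; apply.
    exact: ltnW.
  by have := H (size s); rewrite size_rcons nth_rcons ltnn eqxx; apply.
move=> [H1 H2] i; rewrite size_rcons ltnS leq_eqVlt nth_rcons.
move=> /predU1P[->|si]; first by rewrite ltnn eqxx.
by rewrite si; exact: H1.
Qed.

Lemma cell_rcons_nondecreasing s : nondecreasing_seq (fun k => cell (rcons s k)).
Proof.
move=> k l kl; apply/subsetPset; rewrite !cell_rcons => y [H [j jk ej]].
by split => //; exists j => //; exact: leq_trans kl.
Qed.

Lemma bigcup_cell_rcons s : \bigcup_k cell (rcons s k) = cell s.
Proof.
apply/seteqP; split => [y [k _]|y sy]; first by rewrite cell_rcons => -[].
have r0 : 0 < (size s).+1%:R^-1 :> R by rewrite invr_gt0.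
have [|j yj] := e_dense (open_metric_ball mdY indY y (size s).+1%:R^-1).
  by exists y; rewrite /= (metric_refl mdY).
exists j => //; rewrite cell_rcons; split => //; exists j => //.
by rewrite (metric_sym mdY).
Qed.

Lemma cell_mkseq_nonincreasing sigma :
  nonincreasing_seq (fun n => cell (mkseq sigma n)).
Proof.
apply/nonincreasing_seqP => n; apply/subsetPset.
by rewrite mkseqS cell_rcons => y [].
Qed.

Lemma ultrafilter_bigcup (T : Type) (U : set_system T) (B : nat -> set T) n :
  UltraFilter U -> U (fun y => exists2 j, (j < n)%N & B j y) ->
  exists j, U (B j).
Proof.
move=> UU; elim: n => [|n IH] Un.
  by have [y []] := filter_ex Un.
have [UB|UnB] := in_ultra_setVsetC (B n) UU; first by exists n.
apply: IH; apply: filterS (filterI Un UnB) => y [[j]].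
rewrite ltnS leq_eqVlt => /predU1P[->//|jn Bj _].
by exists j.
Qed.

(** Given [x] in all the closures, an ultrafilter contains the cells and the
    preimages of the neighborhoods of [x].  A cell is covered by finitely many
    small balls, one of which belongs to the ultrafilter; the centers of these
    balls form a Cauchy sequence, and [f] maps its limit to [x]. *)
Lemma bigcap_closure_cell sigma :
  \bigcap_n closure (f @` cell (mkseq sigma n)) `<=` range f.
Proof.
move=> x Hx.
pose F : set_system Y := [set S | exists n W,
  nbhs x W /\ cell (mkseq sigma n) `&` f @^-1` W `<=` S].
have FF : ProperFilter F.
  split.
    move=> [n [W [xW]]]; have [z [[y cy <-] Wy]] := Hx n I _ xW.
    by move=> /(_ y); apply.
  split.
  - by exists 0%N, setT; split => //; exact: filterT.
  - move=> S S' [n [W [xW HS]]] [n' [W' [xW' HS']]].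
    exists (maxn n n'), (W `&` W'); split; first exact: filterI.
    move=> y [cy [Wy W'y]]; split.
      apply: HS; split => //; move: cy.
      have /subsetPset := cell_mkseq_nonincreasing sigma (leq_maxl n n').
      exact.
    apply: HS'; split => //; move: cy.
    have /subsetPset := cell_mkseq_nonincreasing sigma (leq_maxr n n').
    exact.
  - move=> S S' SS' [n [W [xW HS]]]; exists n, W; split => //.
    exact: subset_trans HS SS'.
have [U [UU FU]] := ultraFilterLemma FF.
have ball_in_U i : exists j, U [set y | dY (e j) y < i.+1%:R^-1].
  apply: (@ultrafilter_bigcup _ _ _ (sigma i).+1 UU).
  apply: FU; exists i.+1, setT; split; first exact: filterT.
  move=> y [+ _]; rewrite mkseqS cell_rcons size_mkseq => -[_ [j ji ej]].
  by exists j.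
have [c Hc] := choice ball_in_U.
have c_close m n : dY (e (c m)) (e (c n)) < m.+1%:R^-1 + n.+1%:R^-1.
  have [y [/= my ny]] := filter_ex (filterI (Hc m) (Hc n)).
  apply: (le_lt_trans (metric_triangle mdY y _ _)).
  by rewrite [dY y _](metric_sym mdY) ltrD.
have [|y cy] := completeY (u := e \o c).
  move=> r r0; have r2 : 0 < r / 2 by rewrite divr_gt0.
  have [N _ HN] := near_infty_natSinv_lt (PosNum r2).
  exists N => m n Nm Nn; apply: (lt_trans (c_close m n)).
  by rewrite [ltRHS]splitr ltrD//; [exact: (HN m)|exact: (HN n)].
exists y => //; apply: hausX => A B fyA xB.
have /indY[r r0 rA] := cf fyA.
have r2 : 0 < r / 2 by rewrite divr_gt0.
have [N1 _ H1] := near_infty_natSinv_lt (PosNum r2).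
have [N2 _ H2] := cy _ (nbhs_metric_ball indY y r2).
pose n := maxn N1 N2.
have UA : U (f @^-1` A).
  apply: filterS (Hc n) => z /= cz; apply: rA => /=.
  apply: (le_lt_trans (metric_triangle mdY (e (c n)) _ _)).
  rewrite [ltRHS]splitr ltrD//; first exact: (H2 n (leq_maxr _ _)).
  exact: lt_trans cz (H1 n (leq_maxl _ _)).
have UB : U (f @^-1` B).
  by apply: FU; exists 0%N, B; split => // z [].
by have [z [Az Bz]] := filter_ex (filterI UA UB); exists (f z).
Qed.

End souslin_representation_of_analytic_sets.

Section capacity.
Context {R : realType} {X : topologicalZmodType}.
Implicit Types (mu : borel_probability R X) (A : set X).

(** Continuity from below of the outer measure.  Measurable hulls [B k] of the
    [A k] need not increase, but the intersections of the [B m], [m >= k], do. *)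
Lemma completed_bigcup_le mu (A : nat -> set X) (r : R) :
  nondecreasing_seq A -> (forall k, (completed mu (A k) <= r%:E)%E) ->
  (completed mu (\bigcup_k A k) <= r%:E)%E.
Proof.
move=> ndA Ar; have [B HB] := choice (fun k => measurable_hull (Ar k)).
pose C k := \bigcap_(m in [set m | (k <= m)%N]) B m.
have mC k : measurable (C k : set (borel X)).
  by apply: bigcap_measurable => [|m _]; [exists k => /=|have [] := HB m].
have mU : measurable (\bigcup_k C k : set (borel X)) by exact: bigcup_measurable.
have AC : \bigcup_k A k `<=` \bigcup_k C k.
  move=> x [k _ Ax]; exists k => // m /= km; have [_ + _] := HB m; apply.
  by have /subsetPset := ndA _ _ km; apply.
apply: (le_trans (completedS mu AC)); rewrite completed_measurable//.
have cvC : mu (C k) @[k --> \oo] --> mu (\bigcup_k C k).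
  apply: nondecreasing_cvg_mu => // k l kl; apply/subsetPset => x Cx m /= lm.
  by apply: Cx; exact: leq_trans lm.
rewrite -(cvg_lim _ cvC)//; apply: lime_le.
  by apply/cvg_ex; exists (mu (\bigcup_k C k)).
near=> k; have [mB _] := HB k; apply: le_trans.
by apply: le_measure; rewrite ?inE//; apply: bigcap_inf => /=.
Unshelve. all: by end_near. Qed.

End capacity.

(** * The measures that charge a translate of an analytic set *)

Section charging_measures.
Context {R : realType} {X : topologicalZmodType} (d : X -> X -> R).
Hypotheses (md : is_metric d) (ind : metric_induces d).
Hypothesis completeX : forall u : nat -> X, metric_cauchy d u ->
  exists l : X, u @ \oo --> l.
Variable e : nat -> X.
Hypothesis e_dense : forall U, open U -> U !=set0 -> exists n, U (e n).
Context {Y : topologicalType} (dY : Y -> Y -> R).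
Hypotheses (mdY : is_metric dY) (indY : metric_induces dY).
Hypothesis completeY : forall u : nat -> Y, metric_cauchy dY u ->
  exists l : Y, u @ \oo --> l.
Variable eY : nat -> Y.
Hypothesis eY_dense : forall U, open U -> U !=set0 -> exists n, U (eY n).
Variable f : Y -> X.
Hypothesis cf : continuous f.
Implicit Types (mu nu : borel_probability R X).

Let closed_cell (s : seq nat) : set X := closure (f @` cell dY eY s).

Definition charging (c : R) : set (borel_probability R X) :=
  [set mu | exists x (sigma : nat -> nat), forall n,
    (c%:E <= completed mu (translate x (closed_cell (mkseq sigma n))))%E].

Lemma translate_bigcup x (A : nat -> set X) :
  translate x (\bigcup_n A n) = \bigcup_n translate x (A n).
Proof. exact: image_bigcup. Qed.

Lemma translateS x (A B : set X) : A `<=` B -> translate x A `<=` translate x B.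
Proof. exact: image_subset. Qed.

Lemma closed_translate x (D : set X) : closed D -> closed (translate x D).
Proof.
move=> cD; rewrite translateE; apply: (@closed_comp _ _ (fun y => y - x)) => //.
move=> y _; apply: (@continuous_comp _ _ _ (fun y => (y, - x))
  (fun z : X * X => z.1 + z.2)); last exact: add_continuous.
by apply: cvg_pair; [exact: cvg_id|exact: cvg_cst].
Qed.

(** If the outer measure of the translate of [f (cell s)] exceeds [1 / (k + 1)],
    so does that of [f (cell (rcons s i))] for some [i]: this builds [sigma].
    The converse is continuity from above along [sigma]. *)
Lemma test_measuresC_charging :
  ~` test_measures R (range f) = \bigcup_k charging k.+1%:R^-1.
Proof.
apply/seteqP; split => mu.
  move=> /existsNP[x /eqP mux].
  have {}mux : (0 < completed mu (translate x (range f)))%E.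
    by rewrite lt_def mux completed_ge0.
  have [k kmu] : exists k : nat,
      (k.+1%:R^-1%:E < completed mu (translate x (range f)))%E.
    apply: contrapT => /forallNP nk; move: mux; apply/negP; rewrite -leNgt.
    apply/lee_addgt0Pr => r r0; rewrite add0e.
    have [n _ /(_ n (leqnn n)) /= nr] := near_infty_natSinv_lt (PosNum r0).
    have /negP := nk n; rewrite -leNgt => /le_trans; apply.
    by rewrite lee_fin ltW.
  exists k => //; exists x.
  have step s : exists i, (k.+1%:R^-1%:E <
      completed mu (translate x (f @` cell dY eY s)))%E ->
      (k.+1%:R^-1%:E < completed mu (translate x (f @` cell dY eY (rcons s i))))%E.
    apply: contrapT => /forallNP H.
    have /not_implyP[s_gt _] := H 0%N.
    have : (completed mu (translate x (f @` cell dY eY s)) <= k.+1%:R^-1%:E)%E.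
      rewrite -(bigcup_cell_rcons mdY indY eY_dense) image_bigcup.
      rewrite translate_bigcup; apply: completed_bigcup_le.
        move=> i j ij; apply/subsetPset; apply: translateS; apply: image_subset.
        by apply/subsetPset; exact: cell_rcons_nondecreasing.
      by move=> i; have /not_implyP[_ /negP] := H i; rewrite -leNgt.
    by rewrite leNgt s_gt.
  have [nxt Hnxt] := choice step.
  pose t := fix t n := if n is m.+1 then rcons (t m) (nxt (t m)) else [::].
  exists (fun n => nxt (t n)) => n.
  have -> : mkseq (fun n => nxt (t n)) n = t n.
    by elim: n => [//|n IH]; rewrite mkseqS IH.
  apply: (@le_trans _ _ (completed mu (translate x (f @` cell dY eY (t n))))).
    apply: ltW; elim: n => [|n IH]; last exact: Hnxt.
    by rewrite /= cell_nil.
  by apply: completedS; apply: translateS; exact: subset_closure.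
move=> [k _ [x [sigma Hmu]]] /(_ x) mux0.
pose D n := translate x (closed_cell (mkseq sigma n)).
have cD n : closed (D n) by apply: closed_translate; exact: closed_closure.
have mD n : measurable (D n : set (borel X)) by exact: closed_borel.
have mI : measurable (\bigcap_n D n : set (borel X)).
  by apply: bigcap_measurable => //; exists 0%N.
have cvD : mu (D n) @[n --> \oo] --> mu (\bigcap_n D n).
  apply: nonincreasing_cvg_mu => //.
    by rewrite -ge0_fin_numE// fin_num_measure.
  move=> m n mn; apply/subsetPset; apply: translateS; apply: closureS.
  by apply: image_subset; apply/subsetPset; exact: cell_mkseq_nonincreasing.
have : (k.+1%:R^-1%:E <= mu (\bigcap_n D n))%E.
  rewrite -(cvg_lim _ cvD)//; apply: lime_ge.
    by apply/cvg_ex; exists (mu (\bigcap_n D n)).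
  by near=> n; rewrite -completed_measurable//; exact: Hmu.
rewrite -completed_measurable//; apply/negP; rewrite -ltNge.
apply: (@le_lt_trans _ _ 0%E); last by rewrite lte_fin invr_gt0.
rewrite -mux0; apply: completedS => y Dy.
rewrite translateE /=; apply: (bigcap_closure_cell mdY indY completeY cf
  (metric_hausdorff md ind) (e := eY) (sigma := sigma)).
by move=> n _; have := Dy n I; rewrite /D translateE.
Unshelve. all: by end_near. Qed.

(** The first components of [w] bound the codes of points of [Y], the second
    ones code the translation vector [x]. *)
Definition charging_scheme (c : R) (w : seq (nat * nat)) :
    set (borel_probability R X) :=
  closure [set mu | exists2 x,
    forall i, (i < size w)%N -> d (e (nth (0%N, 0%N) w i).2) x < i.+1%:R^-1 &
    (c%:E <= completed mu (translate x (closed_cell (map fst w))))%E].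

(** A measure [mu] in all the closed sets along a branch is the limit of measures
    that charge translates by vectors [x'] converging to the point [x] coded by
    the branch; semicontinuity passes the lower bound to [mu] and [x]. *)
Lemma charging_souslin c : charging c = souslin (charging_scheme c).
Proof.
have mapfst (p : nat -> nat * nat) n :
    map fst (mkseq p n) = mkseq (fst \o p) n by rewrite /mkseq -map_comp.
apply/seteqP; split => mu.
  move=> [x [sigma Hmu]].
  have /choice[tau Htau] : forall i : nat, exists j, d (e j) x < i.+1%:R^-1.
    move=> i; have [|j xj] := e_dense (open_metric_ball md ind x i.+1%:R^-1).
      by exists x; rewrite /= (metric_refl md) invr_gt0.
    by exists j; rewrite (metric_sym md).
  exists (fun i => (sigma i, tau i)) => n; apply: subset_closure.
  exists x; last by rewrite mapfst; exact: Hmu.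
  by move=> i; rewrite size_mkseq => ni; rewrite nth_mkseq//=.
move=> [p Hp].
have close i j : d (e (p i).2) (e (p j).2) < i.+1%:R^-1 + j.+1%:R^-1.
  have [nu [[x xp _] _]] := Hp (maxn i j).+1 _ filterT.
  apply: (le_lt_trans (metric_triangle md x _ _)).
  rewrite [d x _](metric_sym md).
  have xpi l : (l < (maxn i j).+1)%N -> d (e (p l).2) x < l.+1%:R^-1.
    by move=> lij; have := xp l; rewrite size_mkseq nth_mkseq//; apply.
  by rewrite ltrD//; apply: xpi; rewrite ltnS ?leq_maxl ?leq_maxr.
have [|x ex] := completeX (u := fun i => e (p i).2).
  move=> r r0; have r2 : 0 < r / 2 by rewrite divr_gt0.
  have [N _ HN] := near_infty_natSinv_lt (PosNum r2).
  exists N => m n Nm Nn; apply: (lt_trans (close m n)).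
  by rewrite [ltRHS]splitr ltrD//; [exact: (HN m)|exact: (HN n)].
exists x, (fst \o p) => m; rewrite leNgt; apply/negP => mum.
have [r r0 mur] := translate_semicontinuous md ind (@closed_closure _ _) mum.
have r2 : 0 < r / 2 by rewrite divr_gt0.
have [N1 _ H1] := near_infty_natSinv_lt (PosNum r2).
have [N2 _ H2] := ex _ (nbhs_metric_ball ind x r2).
pose n := maxn m (maxn N1 N2).
have N1n : (N1 <= n)%N by rewrite /n !leq_max leqnn orbT.
have N2n : (N2 <= n)%N by rewrite /n !leq_max leqnn !orbT.
have [nu [[x' x'p nux'] /(_ x')]] := Hp n.+1 _ mur.
have xx' : d x x' < r.
  apply: (le_lt_trans (metric_triangle md (e (p n).2) _ _)).
  rewrite [ltRHS]splitr ltrD//; first exact: (H2 n N2n).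
  have := x'p n; rewrite size_mkseq nth_mkseq// => /(_ (ltnSn _)) /lt_trans; apply.
  exact: (H1 n N1n).
move=> /(_ xx'); apply/negP; rewrite -leNgt; apply: (le_trans nux').
apply: completedS; apply: translateS; apply: closureS; apply: image_subset.
rewrite mapfst; apply/subsetPset; apply: cell_mkseq_nonincreasing.
by apply: leqW; exact: leq_maxl.
Qed.

End charging_measures.

Theorem theoremA (R : realType) (X : topologicalZmodType)
    (polishX : polish R X) (A : set X)
    (analyticA : analytic R A) (haar_nullA : haar_null R A) :
  meager (test_measures R A) \/ comeager (test_measures R A).
Proof.
have [sX [d [md ind completeX]]] := polishX.
have [e e_dense] := separable_sequence 0 sX.
have [Y [[sY [dY [mdY indY completeY]]] [f cf ->]]] := analyticA.
(* If [Y] is empty, so is [A], and every measure is a test measure. *)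
have [[y0]|nY] := pselect (inhabited Y); last first.
  right; rewrite /comeager; apply: (@meagerS _ _ set0).
    move=> mu; apply => x.
    have -> : translate x (range f) = set0.
      by apply/seteqP; split => // z [_ [y _ _] _]; apply: nY; exists.
    by rewrite completed_measurable// measure0.
  by apply: nowhere_dense_meager; rewrite /nowhere_dense closure0 interior0.
have [eY eY_dense] := separable_sequence y0 sY.
apply: (topological_zero_one
  (test_measuresC_charging md ind mdY indY completeY eY_dense cf)).
  move=> k; rewrite (charging_souslin md ind completeX e_dense).
  by apply: souslin_meager_or_residual => w; exact: closed_closure.
move=> U V oU U0 oV V0.
have [h wh VU] := reweight_transitive md ind e_dense oU U0 oV V0.
exists (reweight h), (reweight (fun x => (h x)^-1)); split => //.
  exact: reweight_homeomorphic.
by move=> mu Tmu x; apply: reweight_null.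
Qed.
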